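(* The odd writhe is an invariant of virtual knotoids and of classical knotoids: if $K$ and $K'$ are virtually equivalent virtual knotoid diagrams, or equivalent classical knotoid diagrams, then $J(K)=J(K')$.
   Context: A (classical) knotoid diagram in $S^2$ (or $\mathbb{R}^2$) is a generic immersion of $[0,1]$ whose only singularities are finitely many transversal double points with over/under information (classical crossings). The images of $0$ and $1$ (tail and head) are distinct from each other and from the crossings; the diagram is oriented from tail to head. The $\Omega$-moves are the Reidemeister moves $\Omega_1,\Omega_2,\Omega_3$ performed inside small disks not containing the endpoints (pulling the strand adjacent to an endpoint over or under another strand is not allowed). Classical knotoid diagrams are equivalent if related by finitely many $\Omega$-moves and isotopy of $S^2$ (resp. $\mathbb{R}^2$). A virtual knotoid diagram is a knotoid diagram in $S^2$ in which some double points are virtual crossings (no over/under information, indicated by a small circle). Virtual knotoid diagrams are virtually equivalent if they are related by finitely many generalized $\Omega$-moves and isotopy of $S^2$; the generalized $\Omega$-moves are the $\Omega$-moves and the moves generated by the detour move: a segment of the diagram whose crossings are all virtual may be replaced by any other segment with the same ends, all of whose crossings with the rest of the diagram are declared virtual; this includes the move $\Omega_v$, by which the strand adjacent to the tail or head may be slid back or forth, deleting or creating consecutive virtual crossings on that strand. Gauss code and parity: label the classical crossings; the Gauss code of a diagram is the sequence of labels of classical crossings met while traversing the diagram from tail to head (each label appears twice; virtual crossings are ignored). A crossing is odd if there is an odd number of labels between its two appearances in the Gauss code, and even otherwise. The odd writhe of $K$ is $J(K)=\sum_{c\in \mathrm{Odd}(K)}\mathrm{sign}(c)$, where $\mathrm{Odd}(K)$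 is the set of odd crossings and $\mathrm{sign}(c)=\pm1$ is the sign of the crossing $c$. *)

(* Defs.v *)
From HB Require Import structures.
From mathcomp Require Import all_boot all_order all_algebra finmap.
From mathcomp Require Import all_classical all_reals all_analysis.
From Stdlib Require Import Relations.

Set Implicit Arguments.
Unset Strict Implicit.
Unset Printing Implicit Defensive.

Import Order.TTheory GRing.Theory Num.Theory.
Import numFieldNormedType.Exports.

Local Open Scope classical_set_scope.
Local Open Scope ring_scope.

(* [f] is C^1 near [x].  A C^1 map on a closed interval, a closed square or
   S^2 is represented by any C^1 extension to a neighbourhood: everything
   below only depends on the values on the smaller set. *)
Definition C1_at (R : realType) (V W : normedModType R) (f : V -> W) (x : V) :
    Prop :=
  (\forall y \near x, differentiable f y) /\
  (forall v : V, {for x, continuous (fun y => 'D_v f y)}).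

(* An embedded oriented surface: its points, its tangent vectors, and an
   area form, positive on the positively oriented tangent bases. *)
Record surface (R : realType) := Surface {
  sdim : nat;
  pts : set 'rV[R]_sdim.+1;
  tangent : 'rV[R]_sdim.+1 -> 'rV[R]_sdim.+1 -> Prop;
  area : 'rV[R]_sdim.+1 -> 'rV[R]_sdim.+1 -> 'rV[R]_sdim.+1 -> R }.

Arguments pts {R} s _.
Arguments tangent {R} s _ _.
Arguments area {R} s _ _ _.

(* The unit sphere of R^3, oriented by the outward normal. *)
Definition sphere (R : realType) : surface R :=
  @Surface R 2 [set x | \sum_i x 0 i ^+ 2 = 1]
    (fun x v => \sum_i x 0 i * v 0 i = 0)
    (fun x u v => \det (\matrix_(i < 3) [:: x; u; v]`_i)).

Definition plane (R : realType) : surface R :=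
  @Surface R 1 setT (fun _ _ => True)
    (fun _ u v => \det (\matrix_(i < 2) [:: u; v]`_i)).

Inductive passage := Over | Under | Virtual.

Section Diagrams.
Context {R : realType}.

Definition unit_itv (t : R) : Prop := 0 <= t <= 1.

(* [info t] is only meaningful when [t] is one of the two parameters of a
   double point: it tells how the strand through [t] passes there. *)
Record diagram (S : surface R) := Diagram {
  curve :> R -> 'rV[R]_(sdim S).+1;
  info : R -> passage;
  curve_pts : forall t, unit_itv t -> pts S (curve t);
  curve_C1 : forall t, unit_itv t -> C1_at curve t;
  curve_immersion : forall t, unit_itv t -> 'D_1 curve t != 0;
  curve_finite : finite_set [set t | unit_itv t /\
    exists s, [/\ unit_itv s, s != t & curve s = curve t]];
  curve_double : forall r s t, unit_itv r -> unit_itv s -> unit_itv t ->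
    curve r = curve s -> curve s = curve t -> [\/ r = s, s = t | r = t];
  curve_transversal : forall s t, unit_itv s -> unit_itv t -> s != t ->
    curve s = curve t -> area S (curve s) ('D_1 curve s) ('D_1 curve t) != 0;
  curve_tail : forall t, unit_itv t -> curve t = curve 0 -> t = 0;
  curve_head : forall t, unit_itv t -> curve t = curve 1 -> t = 1;
  info_double : forall s t, unit_itv s -> unit_itv t -> s != t ->
    curve s = curve t ->
    match info s with
    | Over => info t = Under
    | Under => info t = Over
    | Virtual => info t = Virtual
    end }.

Definition double_time (S : surface R) (K : diagram S) (t : R) : Prop :=
  unit_itv t /\ exists s, [/\ unit_itv s, s != t & K s = K t].

Definition classical_diagram (S : surface R) (K : diagram S) : Prop :=
  forall t, double_time K t -> info K t <> Virtual.

Definition classical_times (S : surface R) (K : diagram S) : seq R :=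
  sort <=%R (fset_set [set t | double_time K t /\ info K t <> Virtual]).

(* The label of a classical crossing is its position on the surface. *)
Definition gauss_code (S : surface R) (K : diagram S) :
    seq 'rV[R]_(sdim S).+1 :=
  map K (classical_times K).

(* The number of entries of [w] strictly between the first two occurrences
   of [c]. *)
Definition gap (T : eqType) (w : seq T) (c : T) : nat :=
  index c (drop (index c w).+1 w).

Definition odd_crossing (S : surface R) (K : diagram S) c : bool :=
  odd (gap (gauss_code K) c).

Definition strand_time (S : surface R) (K : diagram S) (k : passage) c : R :=
  xget 0 [set t | [/\ unit_itv t, K t = c & info K t = k]].

(* +1 iff (over-strand, under-strand) is a positively oriented basis. *)
Definition crossing_sign (S : surface R) (K : diagram S) c : int :=
  sgz (area S c ('D_1 K (strand_time K Over c))
                ('D_1 K (strand_time K Under c))).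

Definition odd_writhe (S : surface R) (K : diagram S) : int :=
  \sum_(c <- undup (gauss_code K) | odd_crossing K c) crossing_sign K c.

Record ambient_isotopy (S : surface R)
    (H : R -> 'rV[R]_(sdim S).+1 -> 'rV[R]_(sdim S).+1) : Prop := {
  isotopy0 : forall x, pts S x -> H 0 x = x;
  isotopy_bij : forall t, unit_itv t -> set_bij (pts S) (pts S) (H t);
  isotopy_C1 : forall t x, unit_itv t -> pts S x -> C1_at (H t) x;
  isotopy_immersion : forall t x v, unit_itv t -> pts S x -> tangent S x v ->
    v != 0 -> 'D_v (H t) x != 0;
  isotopy_continuous : forall t x, unit_itv t -> pts S x ->
    {for (t, x), continuous (fun p => H p.1 p.2)};
  isotopy_continuousD : forall t x v, unit_itv t -> pts S x ->
    {for (t, x), continuous (fun p => 'D_v (H p.1) p.2)} }.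

Definition isotopy_move (S : surface R) (K K' : diagram S) : Prop :=
  exists H, [/\ ambient_isotopy H,
    forall t, unit_itv t -> K' t = H 1 (K t) &
    forall t, double_time K t -> info K' t = info K t].

(* [K'] is the part of [K] over [[a, b]], up to an orientation preserving
   change of parameter. *)
Definition restriction (a b : R) (S : surface R) (K K' : diagram S) : Prop :=
  exists rho : R -> R,
    [/\ rho 0 = a, rho 1 = b,
        forall t, unit_itv t -> C1_at rho t /\ 0 < 'D_1 rho t,
        forall t, unit_itv t -> K' t = K (rho t) &
        forall t, double_time K' t -> info K' t = info K (rho t)].

Definition reparametrization (S : surface R) (K K' : diagram S) : Prop :=
  restriction 0 1 K K'.

Definition pt (x y : R) : 'rV[R]_2 := \row_(i < 2) [:: x; y]`_i.

Definition square : set 'rV[R]_2 := [set p | forall i, -1 <= p 0 i <= 1].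

Record disk (S : surface R) (phi : 'rV[R]_2 -> 'rV[R]_(sdim S).+1) : Prop := {
  disk_pts : forall p, square p -> pts S (phi p);
  disk_inj : forall p q, square p -> square q -> phi p = phi q -> p = q;
  disk_C1 : forall p, square p -> C1_at phi p;
  disk_orient : forall p, square p ->
    0 < area S (phi p) ('D_(pt 1 0) phi p) ('D_(pt 0 1) phi p) }.

(* The diagram meets the disk exactly in the strands over the pairwise
   disjoint intervals [[a i, b i]]; the disk contains no endpoint. *)
Definition strands_in_disk (S : surface R) (phi : 'rV[R]_2 -> _) (n : nat)
    (a b : 'I_n -> R) (K : diagram S) : Prop :=
  [/\ forall i, [/\ 0 < a i, a i < b i & b i < 1],
      forall i j, i != j -> b i < a j \/ b j < a i &
      forall t, unit_itv t ->
        ((phi @` square) (K t) <-> exists i, a i <= t <= b i)].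

Definition agree_off (A : set R) (S : surface R) (K K' : diagram S) : Prop :=
  (forall t, unit_itv t -> ~ A t -> K' t = K t) /\
  (forall s t, unit_itv s -> unit_itv t -> ~ A s -> ~ A t -> s != t ->
     K s = K t -> info K' t = info K t).

(* [K] and [K'] differ only inside the disk [phi @` square], which both meet
   in [n] strands. *)
Definition local_move (S : surface R) (phi : 'rV[R]_2 -> _) (n : nat)
    (a b : 'I_n -> R) (K K' : diagram S) : Prop :=
  [/\ disk phi, strands_in_disk phi a b K, strands_in_disk phi a b K' &
      agree_off [set t | exists i, a i < t < b i] K K'].

(* Any arc in a disk with a single double point is, up to an isotopy of the
   disk, one of the curls of the first Reidemeister move. *)
Definition Omega1 (S : surface R) (K K' : diagram S) : Prop :=
  exists phi (a b : R),
    [/\ local_move phi (fun _ : 'I_1 => a) (fun _ : 'I_1 => b) K K',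
        forall s t, a <= s <= b -> a <= t <= b -> K s = K t -> s = t &
        exists p q, [/\ a < p, p < q & q < b] /\
          [/\ K' p = K' q, info K' p <> Virtual &
              forall s t, a <= s -> s < t -> t <= b -> K' s = K' t ->
                s = p /\ t = q]].

(* The strand of [K] over [[a, b]] is the graph of [f] in the disk, run
   through in one of the two directions. *)
Definition strand_graph (S : surface R) (phi : 'rV[R]_2 -> _) (a b : R)
    (K : diagram S) (f : R -> R) : Prop :=
  (forall x, -1 <= x <= 1 -> C1_at f x /\ -1 < f x < 1) /\
  exists x : R -> R,
    [/\ (x a = -1 /\ x b = 1) \/ (x a = 1 /\ x b = -1),
        forall t, a <= t <= b -> C1_at x t /\ 'D_1 x t != 0 &
        forall t, a <= t <= b -> K t = phi (pt (x t) (f (x t)))].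

(* Two strands, disjoint in [K], bound a bigon in [K'], where one of them
   passes over the other twice. *)
Definition Omega2 (S : surface R) (K K' : diagram S) : Prop :=
  exists phi (a b : 'I_2 -> R) (f g : 'I_2 -> R -> R) (k : passage),
    [/\ local_move phi a b K K',
        forall i, strand_graph phi (a i) (b i) K (f i) /\
                  strand_graph phi (a i) (b i) K' (g i),
        forall x, -1 <= x <= 1 -> f ord0 x < f ord_max x,
        exists u v, [/\ -1 < u, u < v, v < 1 &
          forall x, -1 <= x <= 1 ->
            (g ord0 x = g ord_max x <-> x = u \/ x = v)] &
        k <> Virtual /\
        forall s t, a ord0 <= s <= b ord0 -> a ord_max <= t <= b ord_max ->
          K' s = K' t -> info K' s = k].

(* The graphs of [f] and [g] over [-1, 1] meet only above [u]. *)
Definition meet_once (f g : R -> R) (u : R) : Prop :=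
  -1 < u < 1 /\ forall x, -1 <= x <= 1 -> (f x = g x <-> x = u).

Definition stacked (S : surface R) (n : nat) (a b : 'I_n -> R)
    (h : 'I_n -> nat) (K : diagram S) : Prop :=
  forall i j s t, i != j -> a i <= s <= b i -> a j <= t <= b j -> K s = K t ->
    info K s = if (h j < h i)%N then Over else Under.

(* Three strands crossing pairwise once, stacked at pairwise distinct heights
   [h]: the triangle they bound is turned over, as in the braid relation
   [sigma1 sigma2 sigma1 = sigma2 sigma1 sigma2], each strand being oriented
   in either direction. *)
Definition Omega3 (S : surface R) (K K' : diagram S) : Prop :=
  exists phi (a b : 'I_3 -> R) (f g : 'I_3 -> R -> R) (h : 'I_3 -> nat),
    let i0 : 'I_3 := inord 0 in
    let i1 : 'I_3 := inord 1 in
    let i2 : 'I_3 := inord 2 in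
    [/\ local_move phi a b K K',
        forall i, strand_graph phi (a i) (b i) K (f i) /\
                  strand_graph phi (a i) (b i) K' (g i),
        [/\ injective h, stacked a b h K & stacked a b h K'],
        [/\ f i0 (-1) < f i1 (-1), f i1 (-1) < f i2 (-1),
            f i2 1 < f i1 1 & f i1 1 < f i0 1] &
        (exists u01 u02 u12, [/\ meet_once (f i0) (f i1) u01,
            meet_once (f i0) (f i2) u02, meet_once (f i1) (f i2) u12 &
            u01 < u02 /\ u02 < u12]) /\
        (exists v01 v02 v12, [/\ meet_once (g i0) (g i1) v01,
            meet_once (g i0) (g i2) v02, meet_once (g i1) (g i2) v12 &
            v12 < v02 /\ v02 < v01])].

Definition Omega_move (S : surface R) (K K' : diagram S) : Prop :=
  [\/ Omega1 K K', Omega2 K K' | Omega3 K K'].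

Definition virtual_on (a b : R) (S : surface R) (K : diagram S) : Prop :=
  forall t, a <= t <= b -> double_time K t -> info K t = Virtual.

Definition detour_move (S : surface R) (K K' : diagram S) : Prop :=
  exists a b : R, [/\ 0 <= a, a < b & b <= 1] /\
    [/\ virtual_on a b K, virtual_on a b K' &
        agree_off [set t | a < t < b] K K'].

(* The strand adjacent to the tail (resp. the head) is shortened; its inverse
   lengthens it. *)
Definition Omega_v (S : surface R) (K K' : diagram S) : Prop :=
  exists2 a : R, 0 < a < 1 &
    (virtual_on 0 a K /\ restriction a 1 K K') \/
    (virtual_on a 1 K /\ restriction 0 a K K').

Definition classical_step (S : surface R) (K K' : diagram S) : Prop :=
  [/\ classical_diagram K, classical_diagram K' &
      [\/ reparametrization K K', isotopy_move K K' | Omega_move K K']].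

Definition classical_equivalent (S : surface R) :
    diagram S -> diagram S -> Prop :=
  clos_refl_sym_trans (diagram S) (@classical_step S).

Definition virtual_step (K K' : diagram (sphere R)) : Prop :=
  [\/ reparametrization K K', isotopy_move K K', Omega_move K K' |
      detour_move K K' \/ Omega_v K K'].

Definition virtually_equivalent :
    diagram (sphere R) -> diagram (sphere R) -> Prop :=
  clos_refl_sym_trans (diagram (sphere R)) virtual_step.

End Diagrams.

(* Main.v *)
Require Import Defs.
From mathcomp Require Import all_boot all_order all_algebra finmap.
From mathcomp Require Import all_classical all_reals all_analysis.
From mathcomp Require Import ring lra.
From Stdlib Require Import Relations.

(* Encode each classical crossing as the chord joining its over-passage time to
   its under-passage time. The number of Gauss code letters between the two
   occurrences of a crossing has the parity of the number of other chords
   linked with its chord, because a chord with both ends in between contributes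
   two letters. So the odd writhe is a sum of signs over the chords linked with
   an odd number of others, and each move acts on the chord diagram: isotopies,
   reparametrizations, detours and [Omega_v] keep it; [Omega1] adds an isolated
   chord; [Omega2] adds two parallel chords of opposite signs; [Omega3] flips
   the linking of every pair among three chords, so that each of the three
   parities changes twice. The signs in the last two moves are read off the
   slopes of the graphs at their crossings: a difference of two graphs that
   starts positive decreases at its first zero, and it is increasing at its
   last zero when it ends positive. *)

Set Implicit Arguments.
Unset Strict Implicit.
Unset Printing Implicit Defensive.

Import Order.TTheory GRing.Theory Num.Theory.
Import numFieldNormedType.Exports.

Local Open Scope classical_set_scope.
Local Open Scope ring_scope.

(** * Gauss codes and chord diagrams *)

Section GaussWords.

(** Two difficulties shape the argument. A crossing sign involves velocities, and a curve is an
    arbitrary map outside [[0, 1]]. Velocities of two diagrams can thus be compared only at times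
    around which the curves agree. Hence the care for interior times and for neighbourhoods lying
    off the modified part. An isotopy has no such agreement: there the area spanned by the two
    transported velocities varies continuously and never vanishes, because each stage is an
    immersion, so its sign is constant.

    The second difficulty is to isolate a disk. Both ends of a chord lie at one point, hence both
    inside the disk or both outside. Seen from an outside chord, a time inside is known only by the
    strand carrying it. The local moves then reduce to finitely many booleans. *)

Lemma gap_split (T : eqType) (w1 w2 w3 : seq T) (c : T) :
  c \notin w1 -> c \notin w2 -> gap (w1 ++ c :: w2 ++ c :: w3) c = size w2.
Proof.
move=> c1 c2; rewrite /gap index_cat (negbTE c1) /= eqxx addn0.
rewrite -cat_rcons drop_size_cat ?size_rcons// index_cat (negbTE c2)/=.
by rewrite eqxx addn0.
Qed.

(** Sortedness turns a distance between positions in the word into a count of times. Such a count is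
    insensitive to permutations, so the times can later be regrouped by chords. *)
Lemma gap_map_sorted d (A : orderType d) (T : eqType) (f : A -> T) (w : seq A)
    (s t : A) :
    sorted <%O w -> s \in w -> t \in w -> (s < t)%O -> f s = f t ->
    (forall r, r \in w -> f r = f s -> r = s \/ r = t) ->
  gap (map f w) (f s) = count (fun r => (s < r < t)%O) w.
Proof.
move=> w_sorted ws wt st fst fst_only.
have w_uniq : uniq w by exact: lt_sorted_uniq.
case/splitPr: ws w_sorted wt fst_only w_uniq => w1 w'.
rewrite mem_cat inE => w_sorted wt fst_only w_uniq.
have le_w1 r : r \in w1 -> (r < s)%O.
  move=> rw1; move: w_sorted; rewrite lt_sorted_pairwise pairwise_cat.
  by move=> /andP[/allrelP/(_ r s rw1)]; rewrite mem_head => ->.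
have {wt} : t \in w'.
  case/or3P: wt => // [/le_w1 ts|/eqP ts].
    by have := lt_trans st ts; rewrite ltxx.
  by move: st; rewrite ts ltxx.
move=> /splitPr wt; case: wt w_sorted fst_only w_uniq => w2 w3.
move=> w_sorted fst_only w_uniq.
have w_uniq' := w_uniq; rewrite cat_uniq in w_uniq'.
rewrite map_cat /= map_cat /= -fst gap_split; last 2 first.
- apply/negP => /mapP[r rw1 /esym fr].
  have [|rs|rt] := fst_only r _ fr; first by rewrite mem_cat rw1.
  + by have := le_w1 _ rw1; rewrite rs ltxx.
  + by move: rw1; rewrite rt => /le_w1 /(lt_trans st); rewrite ltxx.
- apply/negP => /mapP[r rw2 /esym fr].
  have [|rs|rt] := fst_only r _ fr;
    first by rewrite mem_cat inE mem_cat rw2 !orbT.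
  + by case/and3P: (w_uniq') => _ _; rewrite /= mem_cat -rs rw2.
  + case/and3P: (w_uniq') => _ _ /= /andP[_].
    by rewrite cat_uniq /= -rt rw2 /= andbF.
move: w_sorted; rewrite lt_sorted_pairwise pairwise_cat /= pairwise_cat /=.
move=> /and3P[_ _] /andP[] /allP s_lt /and3P[] /allrelP lt_t _ /andP[]
  /allP t_lt _.
rewrite count_cat /= ltxx /= count_cat /= ltxx andbF !add0n size_map.
rewrite (@eq_in_count _ _ pred0 w1) ?count_pred0; last first.
  by move=> r /le_w1 rs /=; rewrite lt_gtF.
rewrite (@eq_in_count _ _ pred0 w3) ?count_pred0; last first.
  by move=> r /t_lt rs /=; rewrite [(r < t)%O]lt_gtF ?andbF.
rewrite (@eq_in_count _ _ predT w2) ?count_predT ?addn0 ?add0n//.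
move=> r rw2 /=; rewrite s_lt ?mem_cat ?rw2//=.
by apply: lt_t => //; rewrite mem_head.
Qed.

End GaussWords.

Section ChordDiagrams.
Context {R : realDomainType}.
Implicit Types (c d : R * R) (l : seq (R * R)).

Definition swap c := (c.2, c.1).

(* For chords without common ends: exactly one end of [d] lies between the
   two ends of [c].  With this formula a chord is linked with itself. *)
Definition linked c d :=
  ((c.1 < d.1) (+) (c.2 < d.1)) (+) ((c.1 < d.2) (+) (c.2 < d.2)).

Definition link_parity c l := \big[addb/false]_(d <- l) linked c d.

(** A chord of [l] with distinct ends counts itself in [link_parity]. For a list without repetition,
    the value [false] therefore means an odd number of other linked chords, that is, an odd
    crossing. *)
Definition chord_writhe (g : R * R -> int) l : int :=
  \sum_(c <- l) if link_parity c l then 0 else g c.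

Lemma linked_swapl c d : linked (swap c) d = linked c d.
Proof. by rewrite /linked /= [X in X (+) _]addbC [X in _ (+) X]addbC. Qed.

Lemma linked_swapr c d : linked c (swap d) = linked c d.
Proof. by rewrite /linked /= addbC. Qed.

Lemma linked_self c : c.1 != c.2 -> linked c c.
Proof. by rewrite /linked !ltxx; case: ltgtP. Qed.

Lemma linkedC c d : c.1 != d.1 -> c.1 != d.2 -> c.2 != d.1 -> c.2 != d.2 ->
  linked c d = linked d c.
Proof.
rewrite /linked; case: (ltgtP c.1 d.1) => // _ _;
  case: (ltgtP c.1 d.2) => // _ _;
by case: (ltgtP c.2 d.1) => // _ _; case: (ltgtP c.2 d.2).
Qed.

Lemma link_parity_cat c l l' :
  link_parity c (l ++ l') = link_parity c l (+) link_parity c l'.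
Proof. by rewrite /link_parity big_cat. Qed.

Lemma chord_writhe_cat g l l' : chord_writhe g (l ++ l') =
  \sum_(c <- l) (if link_parity c (l ++ l') then 0 else g c) +
  \sum_(c <- l') (if link_parity c (l ++ l') then 0 else g c).
Proof. by rewrite /chord_writhe big_cat. Qed.

End ChordDiagrams.

Section Chords.
Context {R : realType} {S : surface R}.
Implicit Types K : diagram S.

(* The ends of a chord are the over-passage and the under-passage of a
   classical crossing, in this order. *)
Record crossing_chord K (c : R * R) : Prop := CrossingChord {
  chord_unit1 : unit_itv c.1;
  chord_unit2 : unit_itv c.2;
  chord_neq : c.1 != c.2;
  chord_eq : K c.1 = K c.2;
  chord_over : info K c.1 = Over;
  chord_under : info K c.2 = Under }.

Definition chord_sign K (c : R * R) : int :=
  sgz (area S (K c.1) ('D_1 K c.1) ('D_1 K c.2)).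

Definition lists_chords K (l : seq (R * R)) : Prop :=
  uniq l /\ forall c, c \in l <-> crossing_chord K c.

(** No point is visited three times, so the two chords use the same two times. They cannot be
    interchanged, since one is marked [Over] and the other [Under]. *)
Lemma chord_inj K c d : crossing_chord K c -> crossing_chord K d ->
  K c.1 = K d.1 -> c = d.
Proof.
case: c d => [s t] [s' t'] [/= us ut nst est os ut']
  [/= us' utt' nst' est' os' ut''] ss'.
have -> : s = s'.
  have [//|s't'|st'] := curve_double us us' utt' ss' est'.
    by rewrite s't' eqxx in nst'.
  by move: ut''; rewrite -st' os.
congr (_, _).
have [tt'|e|//] := curve_double ut us utt' (esym est) (etrans ss' est').
  by rewrite tt' eqxx in nst.
by move: ut''; rewrite -e os.
Qed.

Lemma classical_time_chord K t : double_time K t -> info K t <> Virtual ->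
  exists2 c, crossing_chord K c & t = c.1 \/ t = c.2.
Proof.
move=> [ut [s [us st e]]]; have := info_double us ut st e.
case it : (info K t) => //; case js : (info K s) => // _ _.
- by exists (t, s); [split=> //=; rewrite eq_sym|left].
- by exists (s, t); [split|right].
Qed.

Lemma chord_classical_time1 K c : crossing_chord K c ->
  double_time K c.1 /\ info K c.1 <> Virtual.
Proof.
case=> u1 u2 n e o u; split; last by rewrite o.
by split=> //; exists c.2; split=> //; rewrite eq_sym.
Qed.

Lemma chord_classical_time2 K c : crossing_chord K c ->
  double_time K c.2 /\ info K c.2 <> Virtual.
Proof.
case=> u1 u2 n e o u; split; last by rewrite u.
by split=> //; exists c.1; split.
Qed.

Lemma finite_classical_times K :
  finite_set [set t | double_time K t /\ info K t <> Virtual].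
Proof. by apply: sub_finite_set (curve_finite K) => t [[]]. Qed.

Lemma mem_classical_times K t :
  t \in classical_times K <-> double_time K t /\ info K t <> Virtual.
Proof.
rewrite /classical_times mem_sort in_fset_set;
  last exact: finite_classical_times.
by rewrite inE.
Qed.

Lemma lists_chords_exists K : exists l, lists_chords K l.
Proof.
have fin : finite_set [set c | crossing_chord K c].
  have fct := finite_classical_times K.
  apply: (sub_finite_set _ (finite_setX fct fct)) => c cc; split.
    exact: chord_classical_time1.
  exact: chord_classical_time2.
exists (fset_set [set c | crossing_chord K c]); split; first exact: fset_uniq.
by move=> c; rewrite in_fset_set// inE.
Qed.

(** Every classical time is an end of a chord, by [chord_inj] of only one, and an over end is never
    an under end. Sums over the Gauss code thus become sums over chords. *)
Lemma perm_classical_times K l : lists_chords K l ->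
  perm_eq (classical_times K) (map fst l ++ map snd l).
Proof.
move=> [ul lP]; apply: uniq_perm.
- by rewrite sort_uniq fset_uniq.
- rewrite cat_uniq !map_inj_in_uniq ?ul /= ?andbT; last 2 first.
  + move=> c d /lP cc /lP dd cd2; apply: (chord_inj cc dd).
    by rewrite (chord_eq cc) (chord_eq dd) cd2.
  + by move=> c d /lP cc /lP dd cd1; apply: (chord_inj cc dd); rewrite cd1.
  apply/hasPn => _ /mapP[c /lP cc ->]; apply/mapP => -[d /lP dd cd].
  by have := chord_under cc; rewrite cd (chord_over dd).
- move=> t; rewrite mem_cat; apply/idP/idP.
    move=> /mem_classical_times[dt it].
    have [c /lP cl [->|->]] := classical_time_chord dt it.
      by rewrite map_f.
    by rewrite [X in _ || X]map_f ?orbT.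
  move=> /orP[] /mapP[c /lP cc ->]; apply/mem_classical_times.
    exact: chord_classical_time1.
  exact: chord_classical_time2.
Qed.

Lemma odd_count (T : Type) (p : pred T) (s : seq T) :
  odd (count p s) = \big[addb/false]_(x <- s) p x.
Proof.
elim: s => [|x s IHs]; first by rewrite big_nil.
by rewrite big_cons /= oddD IHs oddb.
Qed.

Lemma between_addb (s t r : R) : s < t -> r != s -> r != t ->
  (s < r < t) = (s < r) (+) (t < r).
Proof.
move=> st; case: (ltgtP s r) => // sr _; case: (ltgtP t r) => //=.
by move=> tr; have := lt_trans (lt_trans st tr) sr; rewrite ltxx.
Qed.

(** Modulo 2, a chord other than [c] contributes to the gap the number of its ends between those of
    [c], which is [linked]. The chord [c] contributes nothing to the gap but counts itself in
    [link_parity]; hence the negation. *)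
Lemma odd_crossing_chord K l c : lists_chords K l -> c \in l ->
  odd_crossing K (K c.1) = ~~ link_parity c l.
Proof.
move=> ll cl; have [ul lP] := ll; have cc := (lP c).1 cl.
(* A chord is ordered by height, the Gauss code by time: the earlier end has to be singled out. *)
pose s := Num.min c.1 c.2; pose t := Num.max c.1 c.2.
have cst : (s = c.1 /\ t = c.2) \/ (s = c.2 /\ t = c.1).
  by rewrite /s /t; case: (ltP c.1 c.2) => _; [left|right].
have st : s < t.
  by rewrite /s /t; case: (ltgtP c.1 c.2) (chord_neq cc).
have Kst : K s = K t.
  by case: cst => -[-> ->]; rewrite (chord_eq cc).
have -> : K c.1 = K s.
  by case: cst => -[-> _]; rewrite ?(chord_eq cc).
have [c1T c2T] : c.1 \in classical_times K /\ c.2 \in classical_times K.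
  split; apply/mem_classical_times.
    exact: chord_classical_time1.
  exact: chord_classical_time2.
have [us ut] : unit_itv s /\ unit_itv t.
  by case: cc => u1 u2 _ _ _ _; case: cst => -[-> ->].
rewrite /odd_crossing /gauss_code (@gap_map_sorted _ _ _ _ _ s t) //;
  last 4 first.
- by rewrite lt_sorted_uniq_le sort_uniq fset_uniq sort_le_sorted.
- by case: cst => -[-> _].
- by case: cst => -[_ ->].
- move=> r /mem_classical_times[[ur _] _] rs.
  have [|/eqP|] := curve_double ur us ut rs Kst; [by left| |by right].
  by rewrite lt_eqF.
rewrite odd_count (perm_big _ (perm_classical_times ll)) big_cat !big_map /=.
rewrite -big_split /= (bigD1_seq c) //= /link_parity (bigD1_seq c) //=.
rewrite linked_self ?(chord_neq cc)// addTb.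
have -> : (s < c.1 < t) = false.
  by case: cst => -[-> ->]; rewrite ltxx ?andbF.
have -> : (s < c.2 < t) = false.
  by case: cst => -[-> ->]; rewrite ltxx ?andbF.
rewrite addFb negbK; rewrite big_seq_cond [RHS]big_seq_cond.
apply: eq_bigr => d /andP[/lP dd dc].
have sep r : K r = K d.1 -> r != c.1 /\ r != c.2.
  move=> rd; split; apply: contraNneq dc => rc; apply/eqP;
  by apply: (chord_inj dd cc); rewrite -rd rc ?(chord_eq cc).
have [d1c1 d1c2] := sep d.1 erefl.
have [d2c1 d2c2] := sep d.2 (esym (chord_eq dd)).
rewrite !between_addb//; try by case: cst => -[e1 e2]; rewrite ?e1 ?e2.
by rewrite /linked; case: cst => -[-> ->]; do !case: (_ < _).
Qed.

Lemma strand_time_over K c : crossing_chord K c ->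
  strand_time K Over (K c.1) = c.1.
Proof.
move=> cc; rewrite /strand_time; case: xgetP => [t _ [ut tc it]|/(_ c.1)].
  have [//|e|e] := curve_double ut (chord_unit1 cc) (chord_unit2 cc) tc
    (chord_eq cc).
    by have := chord_neq cc; rewrite e eqxx.
  by move: it; rewrite e (chord_under cc).
by case; split=> //; [exact: chord_unit1 cc|exact: chord_over cc].
Qed.

Lemma strand_time_under K c : crossing_chord K c ->
  strand_time K Under (K c.1) = c.2.
Proof.
move=> cc; rewrite /strand_time; case: xgetP => [t _ [ut tc it]|/(_ c.2)].
  have [e|e|//] := curve_double ut (chord_unit1 cc) (chord_unit2 cc) tc
    (chord_eq cc).
    by move: it; rewrite e (chord_over cc).
  by have := chord_neq cc; rewrite e eqxx.
case; split=> //; [exact: chord_unit2 cc|by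
  rewrite (chord_eq cc)|exact: chord_under cc].
Qed.

(** Any repetition-free list of the chords will do, in any order. Each move can thus choose a list
    adapted to it. *)
Lemma odd_writheE K l : lists_chords K l ->
  odd_writhe K = chord_writhe (chord_sign K) l.
Proof.
move=> ll; have [ul lP] := ll.
have lab_inj : {in l &, injective (fun c : R * R => K c.1)}.
  by move=> c d /lP cc /lP dd; exact: chord_inj.
have pe : perm_eq (undup (gauss_code K)) (map (fun c : R * R => K c.1) l).
  apply: uniq_perm; rewrite ?undup_uniq ?map_inj_in_uniq// => x.
  rewrite mem_undup /gauss_code; apply/mapP/mapP.
    move=> [t /mem_classical_times[dt it] ->].
    have [c cc e] := classical_time_chord dt it; exists c; first exact/lP.
    by case: e => ->; rewrite ?(chord_eq cc).
  move=> [c /lP cc ->]; exists c.1 => //; apply/mem_classical_times.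
  exact: chord_classical_time1.
rewrite /odd_writhe (perm_big _ pe) big_map big_mkcond /chord_writhe.
rewrite big_seq [RHS]big_seq; apply: eq_bigr => c cl.
rewrite (odd_crossing_chord ll cl); case: link_parity => //=.
have cc := (lP c).1 cl.
by rewrite /crossing_sign (strand_time_over cc) (strand_time_under cc).
Qed.

End Chords.

(** * Real analysis *)

Section Calculus.
Context {R : realType}.

Lemma C1_at_differentiable (V W : normedModType R) (f : V -> W) x :
  C1_at f x -> differentiable f x.
Proof. by case=> /nbhs_singleton. Qed.

Lemma derive_linear (V W : normedModType R) (f : V -> W) (x : V) (a b : R)
    (u v : V) : differentiable f x ->
  'D_(a *: u + b *: v) f x = a *: 'D_u f x + b *: 'D_v f x.
Proof. by move=> df; rewrite !deriveE// linearD !linearZ. Qed.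

Lemma derive_compose (U V W : normedModType R) (g : U -> V) (f : V -> W)
    (t w : U) : differentiable g t -> differentiable f (g t) ->
  'D_w (f \o g) t = 'D_('D_w g t) f (g t).
Proof.
move=> dg df; rewrite (deriveE _ (differentiable_comp dg df)) (diff_comp dg df).
by rewrite (deriveE _ df) (deriveE _ dg).
Qed.

Lemma derive_reparam (V : normedModType R) (f : R -> V) (rho : R -> R) (t : R) :
  differentiable rho t -> differentiable f (rho t) ->
  'D_1 (f \o rho) t = 'D_1 rho t *: 'D_1 f (rho t).
Proof.
move=> dr df; rewrite (derive_compose _ dr df) !(deriveE _ df).
by rewrite -linearZ /=; congr ('d f _ _); exact/esym/mulr1.
Qed.

Lemma derive_le0_left (h : R -> R) (l u : R) : derivable h u 1 -> l < u ->
  (forall x, l < x < u -> 0 <= h x) -> h u = 0 -> 'D_1 h u <= 0.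
Proof.
move=> dh lu h_ge0 hu0.
rewrite ['D_1 h u]cvg_at_leftE; last exact: dh.
apply: limr_le.
  rewrite -(cvg_at_leftE (fun s : R => s^-1 *: ((h \o shift u) _ - h u))) //.
  apply: cvg_trans dh; apply: cvg_app => A [e e0 eA]; exists e => // x xe x0.
  exact/eA/ltr0_neq0.
near=> s.
rewrite hu0 subr0 /= [_%:A]mulr1; apply: mulr_le0_ge0.
  by rewrite invr_le0; near: s; exact: nbhs_left_le.
apply: h_ge0; apply/andP; split.
  by rewrite -ltrBlDr; near: s; apply: nbhs_left_gt; rewrite subr_lt0.
by rewrite gtrDr; near: s; exact: nbhs_left_lt.
Unshelve. all: by end_near. Qed.

Lemma derive_ge0_right (h : R -> R) (u r : R) : derivable h u 1 -> u < r ->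
  (forall x, u < x < r -> 0 <= h x) -> h u = 0 -> 0 <= 'D_1 h u.
Proof.
move=> dh ur h_ge0 hu0.
rewrite ['D_1 h u]cvg_at_rightE; last exact: dh.
apply: limr_ge.
  rewrite -(cvg_at_rightE (fun s : R => s^-1 *: ((h \o shift u) _ - h u))) //.
  apply: cvg_trans dh; apply: cvg_app => A [e e0 eA]; exists e => // x xe x0.
  exact/eA/lt0r_neq0.
near=> s.
rewrite hu0 subr0 /= [_%:A]mulr1; apply: mulr_ge0.
  by rewrite invr_ge0; near: s; exact: nbhs_right_ge.
apply: h_ge0; apply/andP; split.
  by rewrite ltrDr; near: s; exact: nbhs_right_gt.
by rewrite -ltrBrDr; near: s; apply: nbhs_right_lt; rewrite subr_gt0.
Unshelve. all: by end_near. Qed.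

(** The intermediate value theorem in the form behind all sign arguments: for the derivative of the
    abscissa along a strand, for the area of transported tangents during an isotopy, and for the
    difference of two graphs. *)
Lemma sgr_nonvanishing (F : R -> R) (a b : R) : a <= b ->
  (forall t, a <= t <= b -> {for t, continuous F}) ->
  (forall t, a <= t <= b -> F t != 0) -> Num.sg (F a) = Num.sg (F b).
Proof.
move=> ab Fc F0; apply/eqP; apply: contraT => sFab.
have [c] : exists2 c, c \in `[a, b] & F c = 0.
  apply: IVT => //.
    apply: continuous_in_subspaceT => t; rewrite inE /= in_itv /=.
    exact: Fc.
  have := F0 a; rewrite lexx ab => /(_ isT) Fa0.
  have := F0 b; rewrite lexx ab => /(_ isT) Fb0.
  move: sFab; rewrite ge_min le_max.
  case: (ltgtP (F a) 0) Fa0 => // Fa _; case: (ltgtP (F b) 0) Fb0 => // Fb _.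
  - by rewrite !ltr0_sg// eqxx.
  - by rewrite !gtr0_sg// eqxx.
by rewrite in_itv /= => cab Fc0; have := F0 c cab; rewrite Fc0 eqxx.
Qed.

(* [x] maps [[a, b]] diffeomorphically onto [[-1, 1]], increasingly if [e = 1]
   and decreasingly if [e = -1]. *)
Record strand_coordinate (a b : R) (x : R -> R) (e : R) : Prop := {
  coord_dir : e = 1 \/ e = -1;
  coord_start : x a = - e;
  coord_end : x b = e;
  coord_diff : forall t, a <= t <= b -> differentiable x t;
  coord_derive : forall t, a <= t <= b -> 0 < e * 'D_1 x t;
  coord_mono : forall s t, a <= s <= b -> a <= t <= b ->
    (s < t) = (e * x s < e * x t) }.

(** The derivative of [x] is continuous and nonzero, so it has one sign on [[a, b]]. Then [x] is
    strictly monotone, and this sign must match the direction given by the end values; [e] records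
    it. *)
Lemma strand_coordinate_exists (a b : R) (x : R -> R) : a < b ->
    (x a = -1 /\ x b = 1) \/ (x a = 1 /\ x b = -1) ->
    (forall t, a <= t <= b -> C1_at x t /\ 'D_1 x t != 0) ->
  exists e, strand_coordinate a b x e.
Proof.
move=> ab xab xC1; have abW := ltW ab.
have dx t : a <= t <= b -> differentiable x t.
  by move=> /xC1[/C1_at_differentiable].
have cx : {within `[a, b], continuous x}.
  apply: continuous_in_subspaceT => t; rewrite inE /= in_itv /= => /dx.
  exact: differentiable_continuous.
have sgD t : a <= t <= b -> Num.sg ('D_1 x a) = Num.sg ('D_1 x t).
  move=> /andP[at_ tb]; apply: (@sgr_nonvanishing (fun t => 'D_1 x t)) => //.
    move=> s /andP[as_ st]; have [|[_ /(_ 1)//]] := xC1 s.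
    by rewrite as_ (le_trans st).
  by move=> s /andP[as_ st]; have [|//] := xC1 s; rewrite as_ (le_trans st).
have oo t : t \in `]a, b[ -> a <= t <= b.
  by rewrite in_itv /= => /andP[/ltW -> /ltW ->].
have [dpos|dneg|d0] := ltgtP 0 ('D_1 x a); last first.
- by have := (xC1 a); rewrite lexx abW -d0 eqxx => /(_ isT)[].
- have Dlt t : a <= t <= b -> 'D_1 x t < 0.
    by move=> /sgD; rewrite ltr0_sg// => /esym/eqP; rewrite sgr_cp0.
  have mono : {in `[a, b] &, {homo x : s t /~ s < t}}.
    apply: ltr0_derive1_lt_cc cx => t /oo tab.
      by apply: diff_derivable; exact: dx.
    by rewrite derive1E; exact: Dlt.
  have [e1 e2] : x a = 1 /\ x b = -1.
    case: xab => // -[e1 e2]; have : x b < x a.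
      by apply: mono; rewrite ?in_itv /= ?lexx ?abW.
    by rewrite e1 e2 => h; exfalso; move: h; apply/negP; rewrite -leNgt; lra.
  exists (-1); split=> //; [by right|by rewrite opprK| |].
    by move=> t /Dlt; rewrite mulN1r oppr_gt0.
  move=> s t sab tab; rewrite !mulN1r ltrN2.
  exact/esym/(leW_nmono_in (le_nmono_in mono)).
- have Dgt t : a <= t <= b -> 0 < 'D_1 x t.
    by move=> /sgD; rewrite gtr0_sg// => /esym/eqP; rewrite sgr_cp0.
  have mono : {in `[a, b] &, {homo x : s t / s < t}}.
    apply: gtr0_derive1_lt_cc cx => t /oo tab.
      by apply: diff_derivable; exact: dx.
    by rewrite derive1E; exact: Dgt.
  have [e1 e2] : x a = -1 /\ x b = 1.
    case: xab => // -[e1 e2]; have : x a < x b.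
      by apply: mono; rewrite ?in_itv /= ?lexx ?abW.
    by rewrite e1 e2 => h; exfalso; move: h; apply/negP; rewrite -leNgt; lra.
  exists 1; split=> //; [by left| |].
    by move=> t /Dgt; rewrite mul1r.
  move=> s t sab tab; rewrite !mul1r.
  exact/esym/(leW_mono_in (le_mono_in mono)).
Qed.

Section StrandCoordinate.
Context (a b : R) (x : R -> R) (e : R).
Context (ab : a < b)
  (xe : strand_coordinate a b x e).

Lemma coord_dirK : e * e = 1.
Proof. by case: (coord_dir xe) => ->; rewrite ?mulr1 ?mulrNN ?mulr1. Qed.

Lemma coord_inj s t : a <= s <= b -> a <= t <= b -> x s = x t -> s = t.
Proof.
move=> sab tab st; apply/eqP; rewrite eq_le !leNgt.
by rewrite (coord_mono xe tab sab) (coord_mono xe sab tab) st ltxx.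
Qed.

Lemma coord_range t : a <= t <= b -> -1 <= x t <= 1.
Proof.
move=> /[dup] tab /andP[at_ tb].
have aab : a <= a <= b by rewrite lexx ltW.
have bab : a <= b <= b by rewrite lexx ltW.
have h1 : e * x a <= e * x t by rewrite leNgt -(coord_mono xe) -?leNgt.
have h2 : e * x t <= e * x b by rewrite leNgt -(coord_mono xe) -?leNgt.
move: h1 h2; rewrite (coord_start xe) (coord_end xe) mulrN coord_dirK.
case: (coord_dir xe) => ->; rewrite ?mul1r ?mulN1r; lra.
Qed.

Lemma coord_onto u : -1 < u < 1 -> exists2 t, a < t < b & x t = u.
Proof.
move=> /andP[u1 u2].
have [||t] := @IVT R x a b u (ltW ab).
- apply: continuous_in_subspaceT => t; rewrite inE /= in_itv /= => tab.
  exact/differentiable_continuous/(coord_diff xe tab).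
- rewrite (coord_start xe) (coord_end xe) ge_min le_max.
  by case: (coord_dir xe) => ->; rewrite ?opprK ?(ltW u1) ?(ltW u2) ?orbT.
rewrite in_itv /= => /andP[at_ tb] xt; exists t => //.
have [ta tb'] : t != a /\ t != b.
  split; apply/eqP => tE; move: xt u1 u2; rewrite tE.
    by rewrite (coord_start xe) => <-; case: (coord_dir xe) => ->;
      rewrite ?opprK ltxx.
  by rewrite (coord_end xe) => <-; case: (coord_dir xe) => ->;
    rewrite ?opprK ltxx.
by rewrite !lt_neqAle at_ tb tb' eq_sym ta.
Qed.

End StrandCoordinate.

End Calculus.

(** * The plane and the sphere *)

Section Surfaces.
Context {R : realType}.

(** What the moves need of the plane and of the sphere, so that both are treated at once. Tangency
    matters in [area_degenerate]: on the sphere, independent vectors spanning a plane through [x]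
    also have area zero. *)
Record smooth_surface (S : surface R) : Prop := SmoothSurface {
  area_swap : forall x u v, area S x u v = - area S x v u;
  area_linear : forall x a b u v w,
    area S x (a *: u + b *: v) w = a * area S x u w + b * area S x v w;
  area_continuous : forall (F : R -> 'rV[R]_(sdim S).+1) G H t,
    {for t, continuous F} -> {for t, continuous G} -> {for t, continuous H} ->
    {for t, continuous (fun s => area S (F s) (G s) (H s))};
  area_degenerate : forall x u v, pts S x -> tangent S x u -> tangent S x v ->
    area S x u v = 0 ->
    exists a b, (a != 0) || (b != 0) /\ a *: u + b *: v = 0;
  tangent_linear : forall x a b u v, tangent S x u -> tangent S x v ->
    tangent S x (a *: u + b *: v);
  tangent_derive : forall (g : R -> 'rV[R]_(sdim S).+1) t, differentiable g t ->
    (\forall s \near t, pts S (g s)) -> tangent S (g t) ('D_1 g t) }.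

(** Indexing coordinates by natural numbers identifies ordinals built differently with the same
    value, so that [ring] sees equal atoms. *)
Lemma row_nat_index n : exists k : 'rV[R]_n -> nat -> R,
  forall (w : 'rV[R]_n) i, w 0 i = k w (val i).
Proof.
exists (fun w m => if insub m is Some i then w 0 i else 0) => w i.
by rewrite valK.
Qed.

Lemma plane_area x u v :
  area (plane R) x u v = u 0 0 * v 0 1 - u 0 1 * v 0 0.
Proof.
rewrite /area /= (expand_det_row _ 0) !big_ord_recl big_ord0 addr0.
rewrite /cofactor !det_mx11 !mxE /=.
have [k kE] := row_nat_index 2.
by rewrite !kE /= /bump /=; ring.
Qed.

Lemma sphere_area x u v : area (sphere R) x u v =
  x 0 0 * (u 0 1 * v 0 2 - u 0 2 * v 0 1) -
  x 0 1 * (u 0 0 * v 0 2 - u 0 2 * v 0 0) +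
  x 0 2 * (u 0 0 * v 0 1 - u 0 1 * v 0 0).
Proof.
rewrite /area /= (expand_det_row _ 0) !big_ord_recl big_ord0 addr0.
rewrite /cofactor !(expand_det_row _ 0) !big_ord_recl !big_ord0 !addr0.
rewrite /cofactor !det_mx11 !mxE /=.
have [k kE] := row_nat_index 3.
by rewrite !kE /= /bump /=; ring.
Qed.

Lemma continuous_coord n (f : R -> 'rV[R]_n) i t : {for t, continuous f} ->
  {for t, continuous (fun s => f s 0 i)}.
Proof.
by move=> fc; apply: (@continuous_comp _ _ _ f
  (fun M : 'rV[R]_n => M 0 i) t fc);
  exact: coord_continuous.
Qed.

Lemma smooth_plane : smooth_surface (plane R).
Proof.
split.
- by move=> x u v; rewrite !plane_area; ring.
- by move=> x a b u v w; rewrite !plane_area !mxE; ring.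
- move=> F G H t Fc Gc Hc.
  under [X in {for _, continuous X}]eq_fun do rewrite plane_area.
  by apply: cvgB; apply: cvgM; exact: continuous_coord.
(* A singular matrix has a nonzero row vector in its left kernel; its entries are the coefficients
   of the linear relation between the rows. *)
- move=> x u v _ _ _ /eqP /det0P[w w0 wuv]; exists (w 0 0), (w 0 1).
  split.
    apply: contraNT w0; rewrite negb_or !negbK => /andP[/eqP w00 /eqP w01].
    apply/eqP/rowP => i; rewrite mxE; case: i => [[|[|]]] // p.
      by rewrite -w00; congr (w 0 _); exact: val_inj.
    by rewrite -w01; congr (w 0 _); exact: val_inj.
  rewrite -wuv; apply/rowP => i;
    rewrite !mxE !big_ord_recl big_ord0 !mxE /= addr0.
  by congr (_ + w 0 _ * _); exact: val_inj.
- by [].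
- by [].
Qed.

Lemma smooth_sphere : smooth_surface (sphere R).
Proof.
split.
- by move=> x u v; rewrite !sphere_area; ring.
- by move=> x a b u v w; rewrite !sphere_area !mxE; ring.
- move=> F G H t Fc Gc Hc.
  under [X in {for _, continuous X}]eq_fun do rewrite sphere_area.
  by apply: cvgD; [apply: cvgB|]; apply: cvgM; try exact: continuous_coord;
    apply: cvgB; apply: cvgM; exact: continuous_coord.
- move=> x u v x1 xu xv /eqP /det0P[w w0 wuv].
  have wE : w 0 0 *: x + (w 0 1 *: u + w 0 2 *: v) = 0.
    rewrite -wuv; apply/rowP => i.
    rewrite !mxE !big_ord_recl big_ord0 !mxE /= addr0.
    by congr (_ + (w 0 _ * _ + w 0 _ * _)); exact: val_inj.
  (* The scalar product of the relation with [x] leaves only this coefficient: [x] has norm one and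
     is orthogonal to [u] and [v]. *)
  have w00 : w 0 0 = 0.
    have : \sum_i x 0 i * (w 0 0 *: x + (w 0 1 *: u + w 0 2 *: v)) 0 i = 0.
      by rewrite wE; apply: big1 => i _; rewrite mxE mulr0.
    under eq_bigr do rewrite !mxE !mulrDr (mulrCA _ (w 0 0)) (mulrCA _ (w 0 1))
      (mulrCA _ (w 0 2)) -expr2.
    rewrite !big_split /= -!mulr_sumr.
    move: x1 xu xv; rewrite /pts /tangent /= => -> -> ->.
    by rewrite mulr1 !mulr0 !addr0.
  move: wE; rewrite w00 scale0r add0r => wE.
  exists (w 0 1), (w 0 2); split=> //.
  apply: contraNT w0; rewrite negb_or !negbK => /andP[/eqP w01 /eqP w02].
  apply/eqP/rowP => i; rewrite mxE; case: i => [[|[|[|]]]] // p.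
  + by rewrite -w00; congr (w 0 _); exact: val_inj.
  + by rewrite -w01; congr (w 0 _); exact: val_inj.
  + by rewrite -w02; congr (w 0 _); exact: val_inj.
- move=> x a b u v; rewrite /tangent /= => xu xv.
  under eq_bigr do rewrite !mxE mulrDr (mulrCA _ a) (mulrCA _ b).
  by rewrite big_split /= -!mulr_sumr xu xv !mulr0 addr0.
- move=> g t dg gS; rewrite /tangent /=.
  have dgt : derivable g t 1 by exact: diff_derivable.
  have dgi i : derivable (fun s => g s 0 i) t 1.
    by move/derivable_mxP : dgt; apply.
  (* Differentiating the equation of the sphere along [g] gives twice the scalar product of [g t]
     with the velocity. *)
  have : 'D_1 (fun s => \sum_i g s 0 i ^+ 2) t = 0.
    transitivity ('D_1 (cst (1 : R)) t); last exact: derive_cst.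
    by apply: near_eq_derive; apply: filterS gS => s; rewrite /pts.
  rewrite (_ : (fun _ => _) = \sum_i (fun s => g s 0 i) ^+ 2); last first.
    by apply/funext => s; rewrite fct_sumE; apply: eq_bigr => i _; rewrite fctE.
  rewrite derive_sum; last by move=> i; exact: derivableX.
  move=> sum0.
  have {sum0} : 2%:R * (\sum_i g t 0 i * ('D_1 g t) 0 i) = 0.
    rewrite -[RHS]sum0 mulr_sumr; apply: eq_bigr => i _.
    by rewrite deriveX// (derive_mx dgt) mxE /= expr1 mulrA.
  by move=> /eqP; rewrite mulf_eq0 pnatr_eq0 /= => /eqP.
Qed.

End Surfaces.

(** * Global moves *)

Section Moves.
Context {R : realType} {S : surface R}.
Context (smoothS : smooth_surface S).
Implicit Types K : diagram S.

Lemma area_linear_r x a b u v w :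
  area S x w (a *: u + b *: v) = a * area S x w u + b * area S x w v.
Proof. by rewrite !(area_swap smoothS x w) (area_linear smoothS); ring. Qed.

Lemma area_self x u : area S x u u = 0.
Proof. by have := area_swap smoothS x u u; lra. Qed.

Lemma area_scale x a b u v :
  area S x (a *: u) (b *: v) = a * b * area S x u v.
Proof.
have scaleD c (w : 'rV[R]_(sdim S).+1) : c *: w = c *: w + 0 *: w.
  by rewrite scale0r addr0.
by rewrite (scaleD a) (scaleD b) (area_linear smoothS) !area_linear_r; ring.
Qed.

Lemma curve_differentiable K t : unit_itv t -> differentiable K t.
Proof. by move/(curve_C1 K)/C1_at_differentiable. Qed.

(** The tail and the head are simple points. Around a double time the curve is therefore still
    inside [[0, 1]], where its values, and hence its velocity, are meaningful. *)
Lemma double_time_interior K t : double_time K t -> 0 < t < 1.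
Proof.
move=> [/[dup] ut /andP[t0 t1] [s [us st Kst]]].
rewrite !lt_neqAle t0 t1 !andbT; apply/andP; split; apply/eqP => tE.
  move: st; rewrite (_ : s = t) ?eqxx// -tE.
  by apply: (curve_tail us (d := K)); rewrite Kst -tE.
move: st; rewrite (_ : s = t) ?eqxx// tE.
by apply: (curve_head us (d := K)); rewrite Kst tE.
Qed.

Lemma double_time_chord1 K c : crossing_chord K c -> double_time K c.1.
Proof. by case/chord_classical_time1. Qed.

Lemma double_time_chord2 K c : crossing_chord K c -> double_time K c.2.
Proof. by case/chord_classical_time2. Qed.

Lemma near_unit_itv (t : R) : 0 < t < 1 -> \forall s \near t, unit_itv s.
Proof.
move=> t01; near=> s; rewrite /unit_itv.
have : s \in `]0, 1[ by near: s; exact: near_in_itvoo.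
by rewrite in_itv /= => /andP[/ltW -> /ltW ->].
Unshelve. all: by end_near. Qed.

Lemma near_chord K c : crossing_chord K c ->
  (\forall s \near c.1, unit_itv s) /\ (\forall s \near c.2, unit_itv s).
Proof.
move=> cc; split; apply: near_unit_itv; apply: double_time_interior.
  exact: double_time_chord1 cc.
exact: double_time_chord2 cc.
Qed.

(** Linking depends only on the order of the times, so an increasing map that matches chords and
    signs preserves every term. It is used with a change of parameter and with the identity. *)
Lemma odd_writhe_transport K K' (f : R -> R) :
    (forall s t, unit_itv s -> unit_itv t -> (f s < f t) = (s < t)) ->
    (forall c, crossing_chord K' c -> crossing_chord K (f c.1, f c.2)) ->
    (forall d, crossing_chord K d ->
      exists2 c, crossing_chord K' c & d = (f c.1, f c.2)) ->
    (forall c, crossing_chord K' c ->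
      chord_sign K (f c.1, f c.2) = chord_sign K' c) ->
  odd_writhe K = odd_writhe K'.
Proof.
move=> f_mono fK' Kf f_sign; have [l' ll'] := lists_chords_exists K'.
have [ul' l'P] := ll'.
have f_inj s t : unit_itv s -> unit_itv t -> f s = f t -> s = t.
  move=> us ut fst; apply/eqP; rewrite eq_le !leNgt.
  by rewrite -(f_mono t s)// -(f_mono s t)// fst ltxx.
pose F c := (f c.1, f c.2) : R * R.
have ll : lists_chords K (map F l').
  split.
    rewrite map_inj_in_uniq// => c d /l'P cc /l'P dd [e1 e2].
    rewrite [c]surjective_pairing [d]surjective_pairing.
    by congr (_, _); apply: f_inj => //; case: cc; case: dd.
  move=> d; split=> [/mapP[c /l'P cc ->]|/Kf[c /l'P cl ->]]; first exact: fK'.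
  exact: map_f.
rewrite (odd_writheE ll) (odd_writheE ll') /chord_writhe big_map.
rewrite big_seq [RHS]big_seq; apply: eq_bigr => c /l'P cc; rewrite f_sign//.
congr (if _ then _ else _).
rewrite /link_parity big_map big_seq [RHS]big_seq; apply: eq_bigr => d /l'P dd.
by rewrite /linked /= !f_mono//; case: cc; case: dd.
Qed.

(** The parts cut off carry only virtual crossings, so all classical times lie in the image of
    [rho]. Velocities are multiplied by the positive derivative of [rho], which keeps the signs. *)
Lemma odd_writhe_restriction K K' a b : 0 <= a -> b <= 1 ->
  virtual_on 0 a K -> virtual_on b 1 K -> restriction a b K K' ->
  odd_writhe K = odd_writhe K'.
Proof.
move=> a0 b1 virt_a virt_b [rho [rho0 rho1 rhoC1 K'E infoE]].
have rho_diff t : unit_itv t -> differentiable rho t.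
  by move=> /rhoC1[/C1_at_differentiable].
have rhoc : {within `[0, 1], continuous rho}.
  apply: continuous_in_subspaceT => t; rewrite inE /= in_itv /= => ut.
  exact/differentiable_continuous/rho_diff.
have mono : {in `[0, 1] &, {homo rho : s t / s < t}}.
  apply: gtr0_derive1_lt_cc rhoc => t; rewrite in_itv /= => /andP[t0 t1].
    by apply/diff_derivable/rho_diff; rewrite /unit_itv !ltW.
  by rewrite derive1E; have [|] := rhoC1 t; rewrite /unit_itv ?ltW.
have ltE s t : unit_itv s -> unit_itv t -> (rho s < rho t) = (s < t).
  by move=> us ut; apply: (leW_mono_in (le_mono_in mono)); rewrite in_itv.
have leE s t : unit_itv s -> unit_itv t -> (rho s <= rho t) = (s <= t).
  by move=> us ut; rewrite !leNgt ltE.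
have u0 : unit_itv (0 : R) by rewrite /unit_itv lexx ler01.
have u1 : unit_itv (1 : R) by rewrite /unit_itv lexx ler01.
have range t : unit_itv t -> unit_itv (rho t).
  move=> /[dup] ut /andP[t0 t1]; rewrite /unit_itv; apply/andP; split.
    by rewrite (le_trans a0)// -rho0 leE.
  by rewrite (le_trans _ b1)// -rho1 leE.
have onto t : double_time K t -> info K t <> Virtual ->
    exists2 s, unit_itv s & rho s = t.
  move=> dt it; have /andP[t0 t1] := double_time_interior dt.
  have at_ : a < t.
    by rewrite ltNge; apply/negP => ta; apply: it; apply: virt_a;
      rewrite ?(ltW t0).
  have tb : t < b.
    by rewrite ltNge; apply/negP => ta; apply: it; apply: virt_b;
      rewrite ?ta ?(ltW t1).
  have [||s] := @IVT R rho 0 1 t ler01 => //.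
    by rewrite rho0 rho1 ge_min le_max (ltW at_) (ltW tb) orbT.
  by rewrite in_itv /= => us <-; exists s.
have chord' c : crossing_chord K' c -> crossing_chord K (rho c.1, rho c.2).
  move=> cc; have [us ut st Kst os ut'] := cc; split=> //=.
  - exact: range.
  - exact: range.
  - by move: st; rewrite !neq_lt !ltE.
  - by rewrite -!K'E.
  - by rewrite -infoE//; exact: double_time_chord1 cc.
  - by rewrite -infoE//; exact: double_time_chord2 cc.
apply: (@odd_writhe_transport _ _ rho) => //.
- move=> [s' t'] dd; have [/= us' ut' st' Kst' os' ut''] := dd.
  have [s us sE] := onto _ (double_time_chord1 dd) (chord_classical_time1 dd).2.
  have [t ut tE] := onto _ (double_time_chord2 dd) (chord_classical_time2 dd).2.
  move: sE tE => /= sE tE; exists (s, t); last by rewrite /= sE tE.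
  have st : s != t by apply: contraNneq st' => e; rewrite -sE -tE e.
  have K'st : K' s = K' t by rewrite !K'E// sE tE.
  split=> //=.
    by rewrite infoE ?sE//; split=> //; exists t; rewrite eq_sym.
  by rewrite infoE ?tE//; split=> //; exists s.
- move=> c cc; rewrite /chord_sign /=.
  have [n1 n2] := near_chord cc.
  have DE t : unit_itv t -> (\forall s \near t, unit_itv s) ->
      'D_1 K' t = 'D_1 rho t *: 'D_1 K (rho t).
    move=> ut nt; rewrite -derive_reparam; last 2 first.
    + exact: rho_diff.
    + exact/curve_differentiable/range.
    by apply: near_eq_derive; apply: filterS nt => s /K'E.
  have [us ut _ _ _ _] := cc.
  rewrite !DE// area_scale !sgzM K'E//.
  have [_ p1] := rhoC1 _ us; have [_ p2] := rhoC1 _ ut.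
  by rewrite (gtr0_sgz p1) (gtr0_sgz p2) !mul1r.
Qed.

Lemma odd_writhe_reparametrization K K' :
  reparametrization K K' -> odd_writhe K = odd_writhe K'.
Proof.
(* Here the parts cut off are the single times 0 and 1, which are not double. *)
apply: odd_writhe_restriction => // t /le_anti <- /double_time_interior.
  by rewrite ltxx.
by rewrite ltxx andbF.
Qed.

Lemma odd_writhe_Omega_v K K' : Omega_v K K' -> odd_writhe K = odd_writhe K'.
Proof.
move=> [a /andP[a0 a1]] [[vK rK]|[vK rK]].
  apply: odd_writhe_restriction vK _ rK => //; first exact: ltW.
  by move=> t /le_anti <- /double_time_interior; rewrite ltxx andbF.
apply: odd_writhe_restriction _ vK rK => //; first exact: ltW.
by move=> t /le_anti <- /double_time_interior; rewrite ltxx.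
Qed.

(** If the area vanished at some time, the transported vectors would be dependent, so the
    differential of [H t] would kill a combination of [u] and [v]. The immersion condition makes
    this combination zero, against the nonzero area of [u] and [v]. *)
Lemma area_isotopy H x u v : ambient_isotopy H -> pts S x ->
    tangent S x u -> tangent S x v -> area S x u v != 0 ->
    (forall t, unit_itv t -> tangent S (H t x) ('D_u (H t) x)) ->
    (forall t, unit_itv t -> tangent S (H t x) ('D_v (H t) x)) ->
  sgz (area S (H 1 x) ('D_u (H 1) x) ('D_v (H 1) x)) =
  sgz (area S (H 0 x) ('D_u (H 0) x) ('D_v (H 0) x)).
Proof.
move=> [H0 Hbij HC1 Himm Hc HcD] xS xu xv uv tu tv.
pose F t := area S (H t x) ('D_u (H t) x) ('D_v (H t) x).
have along (W : topologicalType) (G : R * 'rV[R]_(sdim S).+1 -> W) t :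
    {for (t, x), continuous G} -> {for t, continuous (fun s => G (s, x))}.
  move=> Gc; apply: (@continuous_comp _ _ _ (fun s => (s, x)) G t) => //.
  by apply: (@cvg_pair _ _ _ (nbhs t) (nbhs t) (nbhs x));
    [exact: cvg_id|exact: cvg_cst].
suff sgF : Num.sg (F 0) = Num.sg (F 1).
  by apply: (@intr_inj R); rewrite -!sgrEz; exact: esym sgF.
apply: (@sgr_nonvanishing R F 0 1) => // t ut.
  apply: (area_continuous smoothS).
  - exact: (along _ (fun p => H p.1 p.2) t (Hc _ _ ut xS)).
  - exact: (along _ (fun p => 'D_u (H p.1) p.2) t (HcD _ _ _ ut xS)).
  - exact: (along _ (fun p => 'D_v (H p.1) p.2) t (HcD _ _ _ ut xS)).
have HxS : pts S (H t x) by have [f _ _] := Hbij _ ut; exact: f.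
apply/eqP => /(area_degenerate smoothS HxS (tu t ut) (tv t ut))[a [b [ab]]].
rewrite -derive_linear; last exact/C1_at_differentiable/HC1.
move=> D0; have lin : a *: u + b *: v = 0.
  apply/eqP; apply: contraT => n0.
  have := Himm t x _ ut xS (tangent_linear smoothS a b xu xv) n0.
  by rewrite D0 eqxx.
have area0 w : area S x 0 w = 0.
  by rewrite -(scale0r w) -[X in area S x _ X]scale1r area_scale !mul0r.
case/orP: ab => ab0; move: uv; apply/negP; rewrite negbK.
  have := area_linear smoothS x a b u v v.
  rewrite lin area0 area_self mulr0 addr0 => /esym/eqP.
  by rewrite mulf_eq0 (negbTE ab0).
have := area_linear smoothS x a b u v u.
rewrite lin area0 area_self mulr0 add0r (area_swap smoothS) mulrN => /esym/eqP.
by rewrite oppr_eq0 mulf_eq0 (negbTE ab0).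
Qed.

Lemma odd_writhe_isotopy K K' : isotopy_move K K' ->
  odd_writhe K = odd_writhe K'.
Proof.
move=> [H [isoH K'E infoE]]; have [H0 Hbij HC1 Himm Hc HcD] := isoH.
have u0 : unit_itv (0 : R) by rewrite /unit_itv lexx ler01.
have u1 : unit_itv (1 : R) by rewrite /unit_itv lexx ler01.
have eqE s t : unit_itv s -> unit_itv t -> (K' s = K' t) <-> (K s = K t).
  move=> us ut; rewrite !K'E//; split=> [|->//].
  have [_ inj _] := Hbij _ u1.
  by apply: inj; rewrite inE; exact: curve_pts.
have chordE c : crossing_chord K c <-> crossing_chord K' c.
  have dd s t : unit_itv s -> unit_itv t -> s != t -> K s = K t ->
      info K' s = info K s /\ info K' t = info K t.
    move=> us ut st e; split; apply: infoE; split=> //; last by exists s.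
    by exists t; rewrite eq_sym.
  split=> -[us ut st e os ut'].
    have [i1 i2] := dd _ _ us ut st e.
    by split; rewrite ?i1 ?i2//; exact/eqE.
  have {}e : K c.1 = K c.2 by exact/eqE.
  have [i1 i2] := dd _ _ us ut st e.
  by split; rewrite -?i1 -?i2.
apply: (@odd_writhe_transport _ _ id) => //=.
- by move=> [s t] /chordE.
- by move=> [s t] /chordE cc; exists (s, t).
move=> [s t] /chordE cc; rewrite /chord_sign /=.
have [/= ns nt] := near_chord cc; have [/= us ut st e _ _] := cc.
have dH r q : unit_itv r -> unit_itv q -> differentiable (H q) (K r).
  by move=> ur uq; apply/C1_at_differentiable/HC1 => //; exact: curve_pts.
have DH r q : unit_itv r -> unit_itv q ->
    'D_1 (H q \o K) r = 'D_('D_1 K r) (H q) (K r).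
  by move=> ur uq; rewrite derive_compose//;
    [exact: curve_differentiable|exact: dH].
(* [H 0] is the identity only on the surface, so its differential is computed along the curve
   itself. *)
have D0 r : unit_itv r -> (\forall p \near r, unit_itv p) ->
    'D_('D_1 K r) (H 0) (K r) = 'D_1 K r.
  move=> ur nr; rewrite -DH//; apply: near_eq_derive;
    apply: filterS nr => p up /=.
  by rewrite H0//; exact: curve_pts.
have D1 r : unit_itv r -> (\forall p \near r, unit_itv p) ->
    'D_('D_1 K r) (H 1) (K r) = 'D_1 K' r.
  move=> ur nr; rewrite -DH//; apply: near_eq_derive;
    apply: filterS nr => p up /=.
  by rewrite K'E.
have tanK r : unit_itv r -> (\forall p \near r, unit_itv p) ->
    tangent S (K r) ('D_1 K r).
  move=> ur nr; apply: (tangent_derive smoothS);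
    first exact: curve_differentiable.
  by apply: filterS nr => p; exact: curve_pts.
have tanH r q : unit_itv r -> (\forall p \near r, unit_itv p) -> unit_itv q ->
    tangent S (H q (K r)) ('D_('D_1 K r) (H q) (K r)).
  move=> ur nr uq; rewrite -DH//;
    apply: (tangent_derive smoothS (g := H q \o K)).
    by apply: differentiable_comp; [exact: curve_differentiable|exact: dH].
  apply: filterS nr => p up /=; have [f _ _] := Hbij _ uq.
  by apply: f; exact: curve_pts.
have tt : tangent S (K s) ('D_1 K t) by rewrite e; exact: tanK.
have tHt q : unit_itv q -> tangent S (H q (K s)) ('D_('D_1 K t) (H q) (K s)).
  by move=> uq; rewrite e; exact: tanH.
have := area_isotopy isoH (curve_pts K us) (tanK _ us ns) tt
  (curve_transversal (d := K) us ut st e) (fun q => tanH s q us ns) tHt.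
have := D1 _ ut nt; have := D0 _ ut nt; rewrite -e => -> ->.
by rewrite (D1 _ us ns) (D0 _ us ns) -(K'E _ us) (H0 _ (curve_pts K us)) => ->.
Qed.

End Moves.

(** * Moves supported in part of the diagram *)

Section LocalMoves.
Context {R : realType} {S : surface R}.
Context (smoothS : smooth_surface S).
Implicit Types K : diagram S.

Lemma agree_off_sym A K K' : agree_off A K K' -> agree_off A K' K.
Proof.
move=> [e i]; split=> [t ut At|s t us ut As At st]; first by rewrite e.
by rewrite !e// => Kst; rewrite (i s t).
Qed.

Lemma agree_off_chord A K K' c : agree_off A K K' -> ~ A c.1 -> ~ A c.2 ->
  crossing_chord K c -> crossing_chord K' c.
Proof.
move=> [e i] A1 A2 [us ut st Kst os ut']; split=> //.
- by rewrite !e.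
- by rewrite (i c.2 c.1) 1?eq_sym.
- by rewrite (i c.1 c.2).
Qed.

(** Agreement at the two ends alone would not give equal velocities, so both ends need a
    neighbourhood off [A]. *)
Lemma agree_off_sign A K K' c : agree_off A K K' -> crossing_chord K c ->
  (\forall t \near c.1, ~ A t) -> (\forall t \near c.2, ~ A t) ->
  chord_sign K c = chord_sign K' c.
Proof.
move=> [e _] cc A1 A2; have [n1 n2] := near_chord cc.
have near_agree (t : R) : (\forall s \near t, unit_itv s) ->
  (\forall s \near t, ~ A s) ->
    \forall s \near t, K s = K' s.
  by move=> nt At; apply: filterS2 nt At => s us As; rewrite e.
rewrite /chord_sign (near_eq_derive _ (near_agree _ n1 A1)).
rewrite (near_eq_derive _ (near_agree _ n2 A2)).
by rewrite (nbhs_singleton (near_agree _ n1 A1)).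
Qed.

Lemma near_outside (a b t : R) : ~ (a <= t <= b) ->
  \forall s \near t, ~ (a <= s <= b).
Proof.
move=> /negP; rewrite negb_and -!ltNge => /orP[ta|bt].
  by near=> s; apply/negP; rewrite negb_and -!ltNge; apply/orP; left;
    near: s; exact: lt_nbhsl.
by near=> s; apply/negP; rewrite negb_and -!ltNge; apply/orP; right;
  near: s; exact: lt_nbhsr.
Unshelve. all: by end_near. Qed.

(** The segment is virtual on the closed interval, so ends of chords stay off it, together with a
    neighbourhood. The curves agree there, and the two diagrams have literally the same chords. *)
Lemma odd_writhe_detour K K' : detour_move K K' -> odd_writhe K = odd_writhe K'.
Proof.
move=> [a [b [[a0 ab b1] [vK vK' KK']]]].
have off (J : diagram S) c : virtual_on a b J -> crossing_chord J c ->
    ~ (a <= c.1 <= b) /\ ~ (a <= c.2 <= b).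
  move=> vJ cc; split=> ab_c.
    by have := vJ _ ab_c (double_time_chord1 cc); rewrite (chord_over cc).
  by have := vJ _ ab_c (double_time_chord2 cc); rewrite (chord_under cc).
have offW t : ~ (a <= t <= b) -> ~ (a < t < b).
  by move=> + /andP[/ltW at_ /ltW tb]; apply; rewrite at_.
apply: (@odd_writhe_transport _ _ _ _ id) => //.
- move=> [s t] cc; have [/offW ? /offW ?] := off _ _ vK' cc.
  exact: (agree_off_chord (agree_off_sym KK')).
- move=> [s t] cc; have [/offW ? /offW ?] := off _ _ vK cc.
  by exists (s, t) => //; exact: (agree_off_chord KK').
- move=> [s t] cc; have [nin1 nin2] := off _ _ vK' cc.
  apply/esym/(agree_off_sign (agree_off_sym KK') cc);
    by [apply: filterS (near_outside nin1) => r /offW|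
        apply: filterS (near_outside nin2) => r /offW].
Qed.

Definition in_strands n (a b : 'I_n -> R) (t : R) : Prop :=
  exists i, a i <= t <= b i.

Lemma near_outside_strands n (a b : 'I_n -> R) (t : R) : ~ in_strands a b t ->
  \forall s \near t, ~ in_strands a b s.
Proof.
move=> out; have : \forall s \near t, forall i, ~ (a i <= s <= b i).
  apply: (@filter_forall R 'I_n (fun i s => ~ (a i <= s <= b i)) (nbhs t)
    (nbhs_filter t)) => i.
  apply: near_outside => ati; apply: out.
  by exists i.
by apply: filterS => s sout [i si]; exact: (sout i).
Qed.

(** Lying in the disk is a property of the point, which the two ends share. It is therefore enough
    to test [c.1] when chords are sorted into local and outer ones. *)
Lemma chord_in_strands phi n (a b : 'I_n -> R) K c :
  strands_in_disk phi a b K -> crossing_chord K c ->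
  in_strands a b c.1 <-> in_strands a b c.2.
Proof.
move=> [_ _ diskE] [us ut _ e _ _]; have [h1 h2] := diskE _ us.
by have [h3 h4] := diskE _ ut; split=> [/h2|/h4];
  [rewrite e => /h3|rewrite -e => /h1].
Qed.

Definition lists_local_chords n (a b : 'I_n -> R) K (l : seq (R * R)) : Prop :=
  uniq l /\ forall c, c \in l <-> crossing_chord K c /\ in_strands a b c.1.

Lemma chord_writhe_replace (g g' : R * R -> int) (C L L' : seq (R * R)) :
    {in C, g =1 g'} ->
    {in C, forall c, link_parity c L = link_parity c L'} ->
    \sum_(c <- L) (if link_parity c (C ++ L) then 0 else g c) =
    \sum_(c <- L') (if link_parity c (C ++ L') then 0 else g' c) ->
  chord_writhe g (C ++ L) = chord_writhe g' (C ++ L').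
Proof.
move=> gg' LL' sumL; rewrite !chord_writhe_cat sumL; congr (_ + _).
rewrite big_seq [RHS]big_seq; apply: eq_bigr => c cC.
by rewrite !link_parity_cat LL'// gg'.
Qed.

(** The outer chords [C] are common to both diagrams, with equal signs. There remain their parities,
    which see the disk only through [L] and [L'], and the contributions of the local chords
    themselves. *)
Lemma local_move_writhe phi n (a b : 'I_n -> R) K K' L L' :
    local_move phi a b K K' ->
    lists_local_chords a b K L -> lists_local_chords a b K' L' ->
    (forall C : seq (R * R),
      (forall d, d \in C -> ~ in_strands a b d.1 /\ ~ in_strands a b d.2) ->
      {in C, forall d, link_parity d L = link_parity d L'} /\
      \sum_(c <- L)
        (if link_parity c (C ++ L) then 0 else chord_sign K c) =
      \sum_(c <- L')
        (if link_parity c (C ++ L') then 0 else chord_sign K' c)) ->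
  odd_writhe K = odd_writhe K'.
Proof.
move=> [_ dK dK' KK'] [uL LP] [uL' L'P] LL'.
have [l [ul lP]] := lists_chords_exists K.
have offW t : ~ in_strands a b t -> ~ [set t | exists i, a i < t < b i] t.
  by move=> out [i /andP[/ltW ai /ltW bi]]; apply: out; exists i; rewrite ai.
pose C := [seq c <- l | `[< ~ in_strands a b c.1 >]].
have CP c : c \in C <-> crossing_chord K c /\ ~ in_strands a b c.1.
  rewrite mem_filter; split=> [/andP[/asboolP ? /lP //]|[/lP cl out]].
  by rewrite cl andbT; exact/asboolP.
have C_out d : d \in C -> ~ in_strands a b d.1 /\ ~ in_strands a b d.2.
  by move=> /CP[dd out]; split=> // /(chord_in_strands dK dd).
have C'P c : c \in C <-> crossing_chord K' c /\ ~ in_strands a b c.1.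
  split=> [/[dup] /C_out[/offW nin1 /offW nin2] /CP[cc out]|[cc out]].
    by split=> //; exact: agree_off_chord KK' nin1 nin2 cc.
  apply/CP; split=> //; apply: agree_off_chord (agree_off_sym KK') _ _ (cc).
    exact: offW.
  by apply: offW => /(chord_in_strands dK' cc).
have lists (J : diagram S) N (uN : uniq N)
    (NP : forall c, c \in N <-> crossing_chord J c /\ in_strands a b c.1)
    (CJ : forall c, c \in C <-> crossing_chord J c /\ ~ in_strands a b c.1) :
    lists_chords J (C ++ N).
  split.
    rewrite cat_uniq filter_uniq// uN andbT; apply/hasPn => c /NP[_ cin].
    by apply/negP => /CJ[].
  move=> c; rewrite mem_cat; split=> [/orP[/CJ[]//|/NP[]//]|cc].
  have [cin|cout] := pselect (in_strands a b c.1).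
    by apply/orP; right; exact/NP.
  by apply/orP; left; exact/CJ.
rewrite (odd_writheE (lists _ _ uL LP CP))
  (odd_writheE (lists _ _ uL' L'P C'P)).
have [parity sumL] := LL' C C_out.
apply: chord_writhe_replace parity sumL => c cC; have /CP[cc _] := cC.
have [nin1 nin2] := C_out _ cC.
apply: (agree_off_sign KK' cc).
  by apply: filterS (near_outside_strands nin1) => r /offW.
by apply: filterS (near_outside_strands nin2) => r /offW.
Qed.

Lemma lt_strand n (a b : 'I_n -> R) i (r r' q : R) : a i <= r <= b i ->
  a i <= r' <= b i -> ~ in_strands a b q -> (r < q) = (r' < q) /\
    (q < r) = (q < r').
Proof.
move=> /andP[ar rb] /andP[ar' r'b] out.
have /negP : ~ (a i <= q <= b i) by move=> ?; apply: out; exists i.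
rewrite negb_and -!ltNge => /orP[qa|bq].
  have qr := lt_le_trans qa ar; have qr' := lt_le_trans qa ar'.
  by rewrite qr qr' (lt_gtF qr) (lt_gtF qr').
have rq := le_lt_trans rb bq; have r'q := le_lt_trans r'b bq.
by rewrite rq r'q (lt_gtF rq) (lt_gtF r'q).
Qed.

(** A time outside all strands is before or after each whole strand interval. Sliding an end along
    its strand thus changes no comparison with an outer chord. *)
Lemma linked_strands n (a b : 'I_n -> R) i j (c c' d : R * R) :
    a i <= c.1 <= b i -> a i <= c'.1 <= b i ->
    a j <= c.2 <= b j -> a j <= c'.2 <= b j ->
    ~ in_strands a b d.1 -> ~ in_strands a b d.2 ->
  linked c d = linked c' d /\ linked d c = linked d c'.
Proof.
move=> i1 i1' j2 j2' nin1 nin2; rewrite /linked.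
have [-> ->] := lt_strand i1 i1' nin1; have [-> ->] := lt_strand i1 i1' nin2.
by have [-> ->] := lt_strand j2 j2' nin1; have [-> ->] := lt_strand j2 j2' nin2.
Qed.

Lemma odd_writhe_Omega1 K K' : Omega1 K K' -> odd_writhe K = odd_writhe K'.
Proof.
move=> [phi [a [b [lm Kinj [p [q [[ap pq qb] [K'pq ip onlypq]]]]]]]].
have [_ [ab01 _ _] _ _] := lm; have [a0 ab b1] := ab01 ord0.
have pab : a <= p <= b by rewrite ltW// (ltW (lt_trans pq qb)).
have qab : a <= q <= b by rewrite (ltW (lt_trans ap pq)) ltW.
have uab t : a <= t <= b -> unit_itv t.
  move=> /andP[at_ tb]; rewrite /unit_itv (le_trans _ at_) ?(le_trans tb)//;
  exact: ltW.
have in_ab t : in_strands (fun _ : 'I_1 => a) (fun _ => b) t <-> a <= t <= b.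
  by split=> [[]//|tab]; exists ord0.
pose c0 := if info K' p is Over then (p, q) else (q, p).
have c0E : c0 = (p, q) \/ c0 = (q, p).
  by rewrite /c0; case: (info K' p); [left|right|right].
have npq : p != q by rewrite lt_eqF.
have cc0 : crossing_chord K' c0.
  have := info_double (uab _ pab) (uab _ qab) npq K'pq.
  rewrite /c0; case ipE : (info K' p) => // iq; split=> //=; try exact: uab.
  by rewrite eq_sym.
have [c1ab c2ab] : a <= c0.1 <= b /\ a <= c0.2 <= b.
  by case: c0E => ->.
have [_ dK dK' _] := lm.
apply: (local_move_writhe lm (L := [::]) (L' := [:: c0])).
- split=> // c; split=> // -[cc cin]; have /(chord_in_strands dK cc) := cin.
  move: cin => /in_ab c1 /in_ab c2.
  by have := chord_neq cc; rewrite (Kinj _ _ c1 c2 (chord_eq cc)) eqxx.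
- split=> // c; rewrite inE; split=> [/eqP ->|[cc cin]].
    by split=> //; exact/in_ab.
  have /(chord_in_strands dK' cc) := cin; move: cin => /in_ab c1 /in_ab c2.
  apply/eqP/(chord_inj cc cc0).
  have K'c0 : K' c0.1 = K' p by case: c0E => ->.
  rewrite K'c0; case/andP: c1 c2 => ac1 c1b /andP[ac2 c2b].
  have := chord_neq cc; rewrite neq_lt => /orP[c12|c21].
    by have [-> _] := onlypq _ _ ac1 c12 c2b (chord_eq cc).
  by rewrite (chord_eq cc); have [-> _] :=
    onlypq _ _ ac2 c21 c1b (esym (chord_eq cc)).
move=> C C_out.
(* Both ends of [c0] lie on one strand, so for outer chords [c0] is equivalent to this degenerate
   chord, which is linked with nothing. *)
pose d0 := (a, a) : R * R.
have aab : a <= a <= b by rewrite lexx ltW.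
have d0l d : linked d0 d = false by rewrite /linked /= !addbb.
have d0r d : linked d d0 = false by rewrite /linked /= addbb.
have same d : d \in C -> linked c0 d = false /\ linked d c0 = false.
  move=> /C_out[nin1 nin2].
  have [-> ->] := @linked_strands 1 (fun _ => a) (fun _ => b) ord0 ord0
    c0 d0 d c1ab aab c2ab aab nin1 nin2.
  by rewrite d0l d0r.
split=> [d /same[_ dc]|].
  by rewrite /link_parity big_nil big_seq1 dc.
rewrite big_nil big_seq1 link_parity_cat /link_parity big_seq1.
(* The new chord is linked only with itself: its crossing is even and adds nothing to the sum. *)
rewrite linked_self ?(chord_neq cc0)// big_seq big1 // => d /same[].
by [].
Qed.

End LocalMoves.

(** * Strands crossing a disk *)

Section Strands.
Context {R : realType} {S : surface R}.
Context (smoothS : smooth_surface S).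
Implicit Types K : diagram S.

Lemma pt_inj (x y x' y' : R) : pt x y = pt x' y' -> x = x' /\ y = y'.
Proof.
move=> /rowP e; split; [have := e 0|have := e 1];
by rewrite !mxE.
Qed.

Lemma pt_decomp (x y : R) : pt x y = x *: pt 1 0 + y *: pt 0 1.
Proof.
apply/rowP => i; rewrite !mxE; case: i => [[|[|]]] //= _;
by rewrite !(mulr0, mulr1) ?addr0 ?add0r.
Qed.

Lemma square_pt (x y : R) : -1 <= x <= 1 -> -1 <= y <= 1 -> square (pt x y).
Proof. by move=> x1 y1 [[|[|]]] //= p; rewrite mxE. Qed.

Lemma derive_scalel (W : normedModType R) (k : R -> R) (w : W) (t : R) :
  differentiable k t -> 'D_1 (fun s => k s *: w) t = 'D_1 k t *: w.
Proof.
move=> dk; rewrite (deriveE _ (differentiableZl w dk)) (diffZl w dk).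
by rewrite (deriveE _ dk).
Qed.

Lemma derive_graph (W : normedModType R) (phi : 'rV[R]_2 -> W) (x f : R -> R)
    (t : R) :
    differentiable x t -> differentiable f (x t) ->
    differentiable phi (pt (x t) (f (x t))) ->
  'D_1 (fun s => phi (pt (x s) (f (x s)))) t =
  'D_1 x t *: ('D_(pt 1 0) phi (pt (x t) (f (x t))) +
    'D_1 f (x t) *: 'D_(pt 0 1) phi (pt (x t) (f (x t)))).
Proof.
move=> dx df dphi.
pose g s := pt (x s) (f (x s)).
have dfx : differentiable (f \o x) t by exact: differentiable_comp.
have gE : g = (fun s => x s *: pt 1 0) + (fun s => (f \o x) s *: pt 0 1).
  by apply/funext => s; rewrite /g pt_decomp.
have d1 : differentiable (fun s => x s *: pt 1 0 : 'rV[R]_2) t.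
  exact: differentiableZl.
have d2 : differentiable (fun s => (f \o x) s *: pt 0 1 : 'rV[R]_2) t.
  exact: differentiableZl.
have dg : differentiable g t by rewrite gE; exact: differentiableD.
have Dg : 'D_1 g t = 'D_1 x t *: pt 1 0 + ('D_1 x t * 'D_1 f (x t)) *: pt 0 1.
  rewrite gE deriveD; [|exact: diff_derivable|exact: diff_derivable].
  by rewrite (derive_scalel _ dx) (derive_scalel _ dfx) (derive_reparam dx df).
rewrite -[LHS]/('D_1 (phi \o g) t) derive_compose// Dg derive_linear//.
by rewrite scalerDr scalerA.
Qed.

Lemma area_shear p (u v : 'rV[R]_(sdim S).+1) (r s : R) :
  area S p (u + r *: v) (u + s *: v) = (s - r) * area S p u v.
Proof.
rewrite -{1 2}(scale1r u) (area_linear smoothS) !(area_linear_r smoothS).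
rewrite !(area_self smoothS) (area_swap smoothS p v u); ring.
Qed.

Section System.
Context (phi : 'rV[R]_2 -> 'rV[R]_(sdim S).+1) (n : nat) (a b : 'I_n -> R).
Context (K : diagram S) (f x : 'I_n -> R -> R) (e : 'I_n -> R).
Context (tau : 'I_n -> R -> R).

(* The strand over [[a i, b i]] is the graph of [f i]; its abscissa is [x i],
   increasing or decreasing according to the sign [e i], and [tau i] is the
   inverse of [x i]. *)
Record strand_system : Prop := StrandSystem {
  sys_disk : disk phi;
  sys_in_disk : strands_in_disk phi a b K;
  sys_coord : forall i, strand_coordinate (a i) (b i) (x i) (e i);
  sys_diff : forall i (u : R), -1 <= u <= 1 -> differentiable (f i) u;
  sys_bound : forall i (u : R), -1 <= u <= 1 -> -1 < f i u < 1;
  sys_curve : forall i t, a i <= t <= b i ->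
    K t = phi (pt (x i t) (f i (x i t)));
  sys_time : forall i (u : R), -1 < u < 1 -> a i < tau i u < b i;
  sys_timeK : forall i (u : R), -1 < u < 1 -> x i (tau i u) = u }.

Context (sys : strand_system).

Lemma sys_lt i : a i < b i.
Proof. by have [h _ _] := sys_in_disk sys; have [_] := h i. Qed.

Lemma sys_unit i t : a i <= t <= b i -> unit_itv t.
Proof.
have [h _ _] := sys_in_disk sys; have [a0 _ b1] := h i => /andP[at_ tb].
by rewrite /unit_itv (le_trans (ltW a0) at_) (le_trans tb (ltW b1)).
Qed.

Lemma sys_disjoint i j s t : i != j -> a i <= s <= b i -> a j <= t <= b j ->
  s != t /\ (s < t) = (a i < a j).
Proof.
have [_ h _] := sys_in_disk sys => ij /andP[as_ sb] /andP[at_ tb].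
case: (h i j ij) => lt.
  have st := le_lt_trans sb (lt_le_trans lt at_).
  by rewrite st (lt_trans (sys_lt i) lt) lt_eqF.
have ts := le_lt_trans tb (lt_le_trans lt as_).
by rewrite (lt_gtF ts) (lt_gtF (lt_trans (sys_lt j) lt)) gt_eqF.
Qed.

Lemma sys_timeW i (u : R) : -1 < u < 1 -> a i <= tau i u <= b i.
Proof. by move=> /(sys_time sys i)/andP[/ltW -> /ltW ->]. Qed.

Lemma sys_range i t : a i <= t <= b i -> -1 <= x i t <= 1.
Proof. exact: coord_range (sys_lt i) (sys_coord sys i) t. Qed.

Lemma sys_square i (u : R) : -1 <= u <= 1 -> square (pt u (f i u)).
Proof.
move=> u1; apply: square_pt => //.
by have /andP[/ltW -> /ltW ->] := sys_bound sys i u1.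
Qed.

Lemma sys_point i j s t : a i <= s <= b i -> a j <= t <= b j -> K s = K t ->
  x i s = x j t /\ f i (x i s) = f j (x i s).
Proof.
move=> sab tab; rewrite (sys_curve sys sab) (sys_curve sys tab).
move=> /(disk_inj (sys_disk sys)) => /(_ (sys_square i (sys_range sab))).
move=> /(_ (sys_square j (sys_range tab))) /pt_inj[xx ff].
by rewrite ff xx.
Qed.

Lemma sys_time_unique i t : a i <= t <= b i -> -1 < x i t < 1 ->
  t = tau i (x i t).
Proof.
move=> tab xt; apply: (coord_inj (sys_coord sys i)) => //;
  first exact: sys_timeW.
by rewrite (sys_timeK sys).
Qed.

Lemma sys_curve_time i (u : R) : -1 < u < 1 -> K (tau i u) = phi (pt u (f i u)).
Proof.
by move=> u1; rewrite (sys_curve sys (sys_timeW i u1)) (sys_timeK sys).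
Qed.

Lemma sys_time_lt i (u v : R) : -1 < u < 1 -> -1 < v < 1 ->
  (tau i u < tau i v) = (e i * u < e i * v).
Proof.
move=> u1 v1; rewrite (coord_mono (sys_coord sys i)) ?sys_timeW//.
by rewrite !(sys_timeK sys).
Qed.

Definition slope i j u := 'D_1 (f j) u - 'D_1 (f i) u.

Lemma sys_derive i (u : R) : -1 < u < 1 ->
  'D_1 K (tau i u) = 'D_1 (x i) (tau i u) *:
    ('D_(pt 1 0) phi (pt u (f i u)) +
     'D_1 (f i) u *: 'D_(pt 0 1) phi (pt u (f i u))).
Proof.
move=> u1; have tab := sys_timeW i u1; have xu := sys_timeK sys i u1.
have uW : -1 <= u <= 1 by case/andP: u1 => /ltW -> /ltW ->.
have := @derive_graph _ phi (x i) (f i) (tau i u); rewrite xu => <-.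
- apply: near_eq_derive; near=> s; apply: (sys_curve sys).
  have : s \in `]a i, b i[.
    by near: s; apply: near_in_itvoo; rewrite in_itv /=; exact: sys_time.
  by rewrite in_itv /= => /andP[/ltW -> /ltW ->].
- exact: (coord_diff (sys_coord sys i)).
- exact: (sys_diff sys).
- exact/C1_at_differentiable/(disk_C1 (sys_disk sys))/sys_square.
Unshelve. all: by end_near. Qed.

(** The velocities are multiples of the images of [(1, f')], whose area is the difference of slopes
    times that of the coordinate frame. The factor [r] gathers the speeds and the positive area of
    the frame, leaving the directions [e]. *)
Lemma sys_area i j (u : R) : -1 < u < 1 -> f i u = f j u ->
  exists2 r, 0 < r &
  area S (K (tau i u)) ('D_1 K (tau i u)) ('D_1 K (tau j u)) =
  r * (e i * e j * slope i j u).
Proof.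
move=> u1 fij.
have uW : -1 <= u <= 1 by case/andP: u1 => /ltW -> /ltW ->.
have pos k : 0 < e k * 'D_1 (x k) (tau k u).
  exact/(coord_derive (sys_coord sys k))/sys_timeW.
have ee k : e k * e k = 1 by exact: coord_dirK (sys_coord sys k).
have area_pos := disk_orient (sys_disk sys) (sys_square i uW).
exists (e i * 'D_1 (x i) (tau i u) * (e j * 'D_1 (x j) (tau j u)) *
  area S (phi (pt u (f i u))) ('D_(pt 1 0) phi (pt u (f i u)))
    ('D_(pt 0 1) phi (pt u (f i u)))).
  by apply: mulr_gt0 area_pos; exact: mulr_gt0 (pos i) (pos j).
rewrite !sys_derive// sys_curve_time// -fij area_scale// /slope.
set A := 'D_(pt 1 0) _ _; set B := 'D_(pt 0 1) _ _; set p := phi _.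
rewrite area_shear.
move: (ee i) (ee j) => eei eej.
(* The factors [e i * e i] and [e j * e j], equal to 1, are inserted to turn each derivative of an
   abscissa into its positive form in [r]. *)
by rewrite -[LHS]mul1r -[X in X * _](mulr1 1) -[X in X * _ * _]eei
  -[X in _ * X * _]eej; ring.
Qed.

(** Equal slopes would make the strands tangent, against transversality. This makes strict the weak
    inequalities that one-sided difference quotients give at the first and last crossings. *)
Lemma slope_neq0 i j (u : R) : i != j -> -1 < u < 1 -> f i u = f j u ->
  slope i j u != 0.
Proof.
move=> ij u1 fij; apply/eqP => slope0.
have [r _ areaE] := sys_area u1 fij.
have := sys_disjoint ij (sys_timeW i u1) (sys_timeW j u1) => -[nst _].
have := curve_transversal (d := K) (sys_unit (sys_timeW i u1))
  (sys_unit (sys_timeW j u1)) nst.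
by rewrite areaE slope0 !mulr0 eqxx !sys_curve_time// fij => /(_ erefl).
Qed.

Lemma sys_sub_continuous i j (u : R) : -1 <= u <= 1 ->
  {for u, continuous (f j \- f i)}.
Proof.
move=> u1; apply: continuousB; apply: differentiable_continuous;
exact: (sys_diff sys).
Qed.

Lemma slope_derive i j (u : R) : -1 <= u <= 1 ->
  derivable (f j \- f i) u 1 /\ 'D_1 (f j \- f i) u = slope i j u.
Proof.
move=> u1.
have d k : derivable (f k) u 1 by apply: diff_derivable; exact: (sys_diff sys).
by split; [exact: derivableB|exact: deriveB].
Qed.

Lemma slope_first_crossing i j (u : R) : i != j -> -1 < u < 1 ->
  f i (-1) < f j (-1) ->
  (forall z, -1 <= z < u -> f i z != f j z) -> f i u = f j u ->
  sgz (slope i j u) = -1.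
Proof.
move=> ij u1 f1 ne fij.
have uW : -1 <= u <= 1 by case/andP: u1 => /ltW -> /ltW ->.
apply: ltr0_sgz; rewrite lt_neqAle slope_neq0//=.
have [dh <-] := slope_derive i j uW.
case/andP: u1 => u1 u2.
apply: (derive_le0_left dh u1); last by rewrite /= fij subrr.
move=> z /andP[z1 zu].
have : Num.sg ((f j \- f i) (-1)) = Num.sg ((f j \- f i) z).
  apply: sgr_nonvanishing (ltW z1) _ _ => v /andP[v1 vz].
    by apply: sys_sub_continuous;
      rewrite v1 (le_trans vz (ltW (lt_trans zu u2))).
  by rewrite /= subr_eq0 eq_sym ne// v1 (le_lt_trans vz).
by rewrite gtr0_sg /= ?subr_gt0// => /esym/eqP; rewrite sgr_cp0 => /ltW.
Qed.

Lemma slope_last_crossing i j (u : R) : i != j -> -1 < u < 1 -> f i 1 < f j 1 ->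
  (forall z, u < z <= 1 -> f i z != f j z) -> f i u = f j u ->
  sgz (slope i j u) = 1.
Proof.
move=> ij u1 f1 ne fij.
have uW : -1 <= u <= 1 by case/andP: u1 => /ltW -> /ltW ->.
apply: gtr0_sgz; rewrite lt_neqAle eq_sym slope_neq0//=.
have [dh <-] := slope_derive i j uW.
case/andP: u1 => u1 u2.
apply: (derive_ge0_right dh u2); last by rewrite /= fij subrr.
move=> z /andP[uz z1].
have : Num.sg ((f j \- f i) z) = Num.sg ((f j \- f i) 1).
  apply: sgr_nonvanishing (ltW z1) _ _ => v /andP[zv v1].
    by apply: sys_sub_continuous;
      rewrite v1 (le_trans (ltW (lt_trans u1 uz)) zv).
  by rewrite /= subr_eq0 eq_sym ne// v1 (lt_le_trans uz).
by rewrite [in RHS]gtr0_sg /= ?subr_gt0// => /eqP; rewrite sgr_cp0 => /ltW.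
Qed.

End System.

End Strands.

(** * Chords of the crossings inside a disk *)

Section StrandChords.
Context {R : realType} {S : surface R}.
Context (smoothS : smooth_surface S).
Implicit Types K : diagram S.

(** Puts the time on the higher strand first, as chords require. As [linked] is insensitive to this
    swap, the heights do not affect linking and enter the sign as a factor. *)
Definition orient n (h : 'I_n -> nat) (i j : 'I_n) (c : R * R) :=
  if (h j < h i)%N then c else swap c.

Lemma linked_orient n m (h : 'I_n -> nat) (h' : 'I_m -> nat) i j k l c d :
  linked (orient h i j c) (orient h' k l d) = linked c d.
Proof.
by rewrite /orient; do 2!case: ifP => _; rewrite ?linked_swapl ?linked_swapr.
Qed.

Context (phi : 'rV[R]_2 -> 'rV[R]_(sdim S).+1) (n : nat) (a b : 'I_n -> R).
Context (h : 'I_n -> nat) (h_inj : injective h).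

Section Chords.
Context (K : diagram S) (f x : 'I_n -> R -> R) (e : 'I_n -> R).
Context (tau : 'I_n -> R -> R).
Context (sys : strand_system phi a b K f x e tau) (stackedK : stacked a b h K).

Definition crossing_at (p : 'I_n * 'I_n * R) : R * R :=
  orient h p.1.1 p.1.2 (tau p.1.1 p.2, tau p.1.2 p.2).

Lemma crossing_at_chord i j (u : R) : i != j -> -1 < u < 1 -> f i u = f j u ->
  crossing_chord K (crossing_at (i, j, u)).
Proof.
move=> ij u1 fij.
have [si sj] := (sys_timeW sys i u1, sys_timeW sys j u1).
have [ui uj] := (sys_unit sys si, sys_unit sys sj).
have [nij _] := sys_disjoint sys ij si sj.
have Kij : K (tau i u) = K (tau j u) by rewrite !(sys_curve_time sys)// fij.
have info_ij := stackedK ij si sj Kij.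
have ji : j != i by rewrite eq_sym.
have info_ji := stackedK ji sj si (esym Kij).
rewrite /crossing_at /orient /=;
  case: ltngtP info_ij info_ji => [hlt|hlt|heq] i1 i2.
- by split=> //=.
- by split=> //=; rewrite eq_sym.
- by move: ij; rewrite (h_inj heq) eqxx.
Qed.

Lemma crossing_at_label i j (u : R) : -1 < u < 1 -> f i u = f j u ->
  K (crossing_at (i, j, u)).1 = phi (pt u (f i u)).
Proof.
by move=> u1 fij; rewrite /crossing_at /orient; case: ifP => _ /=;
  rewrite (sys_curve_time sys)// fij.
Qed.

Lemma crossing_at_strands i j (u : R) : -1 < u < 1 ->
  in_strands a b (crossing_at (i, j, u)).1.
Proof.
by move=> u1; rewrite /crossing_at /orient; case: ifP => _ /=;
  [exists i|exists j]; exact: (sys_timeW sys _ u1).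
Qed.

(** Distinct abscissae let the point of a crossing determine its entry in [X]. Each pair of strands
    may be listed in either order, since [orient] gives the same chord for both. *)
Lemma lists_crossings (X : seq ('I_n * 'I_n * R)) :
    uniq [seq p.2 | p <- X] ->
    (forall p, p \in X -> [/\ p.1.1 != p.1.2, -1 < p.2 < 1 &
      f p.1.1 p.2 = f p.1.2 p.2]) ->
    (forall i j u, i != j -> -1 <= u <= 1 -> f i u = f j u ->
      ((i, j, u) \in X) || ((j, i, u) \in X)) ->
  lists_local_chords a b K [seq crossing_at p | p <- X].
Proof.
move=> uX XP X_all; split.
  rewrite map_inj_in_uniq ?(map_uniq uX)// => -[[i j] u] [[k l] v] iX kX e1.
  have [/= ij u1 fij] := XP _ iX; have [/= kl v1 fkl] := XP _ kX.
  have := crossing_at_label u1 fij; rewrite e1 crossing_at_label//.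
  have uW : -1 <= u <= 1 by case/andP: u1 => /ltW -> /ltW ->.
  have vW : -1 <= v <= 1 by case/andP: v1 => /ltW -> /ltW ->.
  move=> /(disk_inj (sys_disk sys) (sys_square sys k vW) (sys_square sys i uW)).
  move=> /pt_inj[vu _].
  have idx p q : p \in X -> q \in X -> p.2 = q.2 -> p = q.
    move=> pX qX pq; rewrite -(nth_index p pX) -(nth_index p qX);
      congr (nth p X).
    apply/eqP; rewrite -(nth_uniq 0 _ _ uX) ?size_map ?index_mem//.
    by rewrite !(nth_map p) ?index_mem// !nth_index// pq.
  exact: idx.
move=> c; split.
  move=> /mapP[[[i j] u] iX ->]; have [/= ij u1 fij] := XP _ iX.
  by split; [exact: crossing_at_chord|exact: crossing_at_strands].
move=> [cc cin]; have := cin => -[i ci].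
have /(chord_in_strands (sys_in_disk sys) cc)[j cj] := cin.
have [xx fij] := sys_point sys ci cj (chord_eq cc).
(* A single strand is a graph with monotone abscissa, so it does not cross itself. *)
have ij : i != j.
  apply: contraNneq (chord_neq cc) => eij; rewrite -eij in xx cj.
  by apply/eqP; exact: (coord_inj (sys_coord sys i)).
have x1 := sys_range sys ci.
have info1 := stackedK ij ci cj (chord_eq cc).
rewrite (chord_over cc) in info1.
have hji : (h j < h i)%N by case: ltnP info1.
set u := x i c.1 in xx fij x1.
have cE : -1 < u < 1 -> c = (tau i u, tau j u).
  move=> u1; rewrite [LHS]surjective_pairing; congr (_, _).
    exact: (sys_time_unique sys).
  by rewrite xx; apply: (sys_time_unique sys) => //; rewrite -xx.
have /orP[iX|jX] := X_all i j u ij x1 fij.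
  have [/= _ u1 _] := XP _ iX.
  by apply/mapP; exists (i, j, u) => //; rewrite /crossing_at /orient /= hji cE.
have [/= _ u1 _] := XP _ jX.
apply/mapP; exists (j, i, u) => //.
by rewrite /crossing_at /orient /= ltnNge (ltnW hji) /= cE.
Qed.

Lemma crossing_at_sign i j (u : R) : -1 < u < 1 -> f i u = f j u ->
  chord_sign K (crossing_at (i, j, u)) =
  (if (h j < h i)%N then 1 else -1) *
    (sgz (e i) * sgz (e j) * sgz (slope f i j u)).
Proof.
move=> u1 fij; have [r r0 areaE] := sys_area smoothS sys u1 fij.
have Kij : K (tau j u) = K (tau i u) by rewrite !(sys_curve_time sys)// fij.
have sgE : sgz (area S (K (tau i u)) ('D_1 K (tau i u)) ('D_1 K (tau j u))) =
    sgz (e i) * sgz (e j) * sgz (slope f i j u).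
  by rewrite areaE !sgzM (gtr0_sgz r0) mul1r.
rewrite /chord_sign /crossing_at /orient /=; case: ifP => _ /=.
  by rewrite mul1r.
by rewrite mulN1r Kij (area_swap smoothS) sgzN sgE.
Qed.

Lemma linked_crossings p q : linked (crossing_at p) (crossing_at q) =
  linked (tau p.1.1 p.2, tau p.1.2 p.2) (tau q.1.1 q.2, tau q.1.2 q.2).
Proof. exact: linked_orient. Qed.

End Chords.

Section Existence.
Context (K : diagram S) (f : 'I_n -> R -> R).

Lemma strand_system_exists : disk phi -> strands_in_disk phi a b K ->
  (forall i, strand_graph phi (a i) (b i) K (f i)) ->
  exists x e tau, strand_system phi a b K f x e tau.
Proof.
move=> dphi dK graphs; have [ab _ _] := dK.
have /choice[x xP] : forall i, exists x : R -> R,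
    [/\ (x (a i) = -1 /\ x (b i) = 1) \/ (x (a i) = 1 /\ x (b i) = -1),
        forall t, a i <= t <= b i -> C1_at x t /\ 'D_1 x t != 0 &
        forall t, a i <= t <= b i -> K t = phi (pt (x t) (f i (x t)))].
  by move=> i; have [_] := graphs i.
have /choice[e eP] : forall i, exists e, strand_coordinate (a i) (b i) (x i) e.
  move=> i; have [_ abi _] := ab i; have [x1 x2 _] := xP i.
  exact: strand_coordinate_exists.
have /choice[tau tauP] : forall i, exists tau_i : R -> R,
    forall u : R, -1 < u < 1 -> a i < tau_i u < b i /\ x i (tau_i u) = u.
  move=> i; have /choice[t tP] : forall u : R, exists t : R,
      -1 < u < 1 -> a i < t < b i /\ x i t = u; last by exists t.
  move=> u; have [u1|] := boolP (-1 < u < 1); last by exists 0.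
  have [_ abi _] := ab i; have [t tab xt] := coord_onto abi (eP i) u1.
  by exists t.
exists x, e, tau; split=> //.
- by move=> i u u1; have [/(_ u u1)[/C1_at_differentiable]] := graphs i.
- by move=> i u u1; have [/(_ u u1)[]] := graphs i.
- by move=> i t tab; have [_ _ ->] := xP i.
- by move=> i u /(tauP i)[].
- by move=> i u /(tauP i)[].
Qed.

End Existence.

(** Outer chords see only which two strands a crossing joins. This compares the two crossings of a
    bigon within one diagram, and corresponding crossings before and after a triangle is turned
    over. *)
Lemma linked_same_strands K K' f f' x x' e e' tau tau' i j (u u' : R) d :
    strand_system phi a b K f x e tau ->
      strand_system phi a b K' f' x' e' tau' ->
    -1 < u < 1 -> -1 < u' < 1 ->
    ~ in_strands a b d.1 -> ~ in_strands a b d.2 ->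
  linked (crossing_at tau (i, j, u)) d = linked
    (crossing_at tau' (i, j, u')) d /\
  linked d (crossing_at tau (i, j, u)) = linked d (crossing_at tau' (i, j, u')).
Proof.
move=> sK sK' u1 u1' d1 d2.
by rewrite /crossing_at /orient /=; case: ifP => _ /=;
  apply: linked_strands d1 d2;
  first [exact: (sys_timeW sK)|exact: (sys_timeW sK')].
Qed.

(** Linking is the exclusive or of four comparisons of times. A comparison between distinct strands
    is the same in both diagrams; one on a common strand is reversed, since the abscissae change
    order while the direction is kept. The last hypothesis says that an odd number of the four are
    reversed. *)
Lemma linked_turn K K' f f' x x' e tau tau' i j k l (u u' v v' : R) :
    strand_system phi a b K f x e tau ->
      strand_system phi a b K' f' x' e tau' ->
    -1 < u < 1 -> -1 < u' < 1 -> -1 < v < 1 -> -1 < v' < 1 ->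
    (u < v /\ v' < u') \/ (v < u /\ u' < v') ->
    ((i == k) (+) (j == k)) (+) ((i == l) (+) (j == l)) ->
  linked (crossing_at tau (i, j, u)) (crossing_at tau (k, l, v)) =
  ~~ linked (crossing_at tau' (i, j, u')) (crossing_at tau' (k, l, v')).
Proof.
move=> sK sK' u1 u1' v1 v1' turn once.
have flip p q : (tau p u < tau q v) = (p == q) (+) (tau' p u' < tau' q v').
  have [->|pq] := eqVneq p q; last first.
    have [_ ->] := sys_disjoint sK pq (sys_timeW sK p u1) (sys_timeW sK q v1).
    by have [_ ->] := sys_disjoint sK' pq (sys_timeW sK' p u1')
      (sys_timeW sK' q v1').
  rewrite (sys_time_lt sK)// (sys_time_lt sK')//.
  by case: (coord_dir (sys_coord sK q)) => ->; rewrite ?mul1r ?mulN1r ?ltrN2;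
    case: turn => -[h1 h2]; rewrite ?h1 ?h2 ?(lt_gtF h1) ?(lt_gtF h2).
rewrite !linked_crossings /linked /= !flip; move: once.
by do 4!case: (_ == _); do 4!case: (_ < _).
Qed.

(** The diagrams still agree at the ends of the intervals, which no open strand interval contains.
    There injectivity of [phi] identifies abscissae and heights; so [g] inherits the order of the
    [f i] on the sides of the square. *)
Lemma strand_system_ends K K' f g x y e e' tau tau' :
    strand_system phi a b K f x e tau -> strand_system phi a b K' g y e' tau' ->
    agree_off [set t | exists i, a i < t < b i] K K' ->
  forall i, [/\ e' i = e i, g i (-1) = f i (-1) & g i 1 = f i 1].
Proof.
move=> sK sK' [KK' _] i; have abi := sys_lt sK i.
have [_ disj _] := sys_in_disk sK.
have aab : a i <= a i <= b i by rewrite lexx ltW.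
have bab : a i <= b i <= b i by rewrite lexx ltW.
have not_open t : t = a i \/ t = b i -> ~ exists j, a j < t < b j.
  move=> tE [j /andP[aj bj]]; have [eij|nij] := eqVneq i j.
    by case: tE aj bj => ->; rewrite -eij ltxx.
  have tab : a i <= t <= b i by case: tE => ->.
  have tabj : a j <= t <= b j by rewrite !ltW.
  by have [] := sys_disjoint sK nij tab tabj; rewrite eqxx.
have ends t : t = a i \/ t = b i ->
    y i t = x i t /\ g i (y i t) = f i (x i t).
  move=> tE; have tab : a i <= t <= b i by case: tE => ->.
  have := KK' t (sys_unit sK tab) (not_open t tE).
  rewrite (sys_curve sK' tab) (sys_curve sK tab).
  move=> /(disk_inj (sys_disk sK)) =>
    /(_ (sys_square sK' i (sys_range sK' tab))).
  by move=> /(_ (sys_square sK i (sys_range sK tab))) /pt_inj.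
have [xa fa] := ends _ (or_introl erefl);
  have [xb fb] := ends _ (or_intror erefl).
have ee : e' i = e i.
  by rewrite -(coord_end (sys_coord sK' i)) xb (coord_end (sys_coord sK i)).
rewrite xa (coord_start (sys_coord sK i)) in fa.
rewrite xb (coord_end (sys_coord sK i)) in fb.
by split=> //; case: (coord_dir (sys_coord sK i)) fa fb => ->; rewrite ?opprK.
Qed.

End StrandChords.

Lemma clos_refl_sym_trans_invariant (T U : Type) (r : relation T) (F : T -> U) :
  (forall x y, r x y -> F x = F y) ->
  forall x y, clos_refl_sym_trans T r x y -> F x = F y.
Proof.
by move=> rF x y; elim=> [u v /rF|u|u v _ ->|u v w _ -> _ ->].
Qed.

(** * The second and third Reidemeister moves *)

Section CrossingMoves.
Context {R : realType} {S : surface R}.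
Context (smoothS : smooth_surface S).
Implicit Types K : diagram S.

Lemma odd_writhe_Omega2 K K' : Omega2 K K' -> odd_writhe K = odd_writhe K'.
Proof.
move=> [phi [a [b [f [g [k [lm graphs f_lt [u [v [u1 uv v1 gE]]]
  [kV infoK']]]]]]]].
have [dphi dK dK' KK'] := lm.
have [x [e [tau sK]]] := strand_system_exists dphi dK (fun i => (graphs i).1).
have [x' [e' [tau' sK']]] := strand_system_exists dphi dK'
  (fun i => (graphs i).2).
have ends := strand_system_ends sK sK' KK'.
have I2 (i j : 'I_2) : i != j ->
  (i, j) = (ord0, ord_max) \/ (i, j) = (ord_max, ord0).
  case: i j => [[|[|//]] pi] [[|[|//]] pj] // _; [left|right];
  by congr (_, _); exact: val_inj.
have n01 : ord0 != ord_max :> 'I_2 by [].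
have f_ne i j (z : R) : i != j -> -1 <= z <= 1 -> f i z != f j z.
  move=> /I2[] [-> ->] /f_lt; first by move/lt_eqF => ->.
  by move/gt_eqF => ->.
pose over := if k is Over then true else false.
(* Heights 0 and 1 encode that the strand [ord0] passes as [k] at both crossings, which makes the
   bigon a case of [stacked]. *)
pose h (i : 'I_2) : nat := (i == ord0) == over.
have h_inj : injective h.
  move=> i j; have [//|/I2[] [-> ->]] := eqVneq i j; by rewrite /h;
    case: (over).
have stackedK : stacked a b h K.
  move=> i j s t ij si tj Kst; have [_ /eqP] := sys_point sK si tj Kst.
  by rewrite (negbTE (f_ne _ _ _ ij (sys_range sK si))).
have stackedK' : stacked a b h K'.
  move=> i j s t ij; have [] := I2 _ _ ij => -[-> ->] si tj K'st.
    by rewrite (infoK' _ _ si tj K'st) /h /over; case: (k) kV.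
  have := infoK' _ _ tj si (esym K'st).
  have [nts _] := sys_disjoint sK' n01 tj si.
  have := info_double (sys_unit sK' tj) (sys_unit sK' si) nts (esym K'st).
  by move=> + infot; rewrite /h /over infot; case: (k) kV.
have u_in : -1 < u < 1 by rewrite u1 (lt_trans uv).
have v_in : -1 < v < 1 by rewrite v1 (lt_trans u1).
have W (z : R) : -1 < z < 1 -> -1 <= z <= 1 by case/andP => /ltW -> /ltW ->.
have gu : g ord0 u = g ord_max u by apply/gE; [exact: W|left].
have gv : g ord0 v = g ord_max v by apply/gE; [exact: W|right].
have lK : lists_local_chords a b K [::].
  have := lists_crossings h_inj sK stackedK (X := [::]).
  apply=> // i j z ij z1 /eqP.
  by rewrite (negbTE (f_ne _ _ _ ij z1)).
pose X : seq ('I_2 * 'I_2 * R) := [:: (ord0, ord_max, u); (ord0, ord_max, v)].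
have lK' : lists_local_chords a b K' [seq crossing_at h tau' p | p <- X].
  apply: (lists_crossings h_inj sK' stackedK').
  - by rewrite /= inE lt_eqF.
  - by move=> p; rewrite !inE => /orP[] /eqP ->.
  - move=> i j z /I2[] [-> ->] z1 gz.
      have /gE[] := gz => // ->; first by rewrite mem_head.
      by rewrite !inE eqxx orbT.
    have /gE[] := esym gz => // ->; first by rewrite [X in _ || X]mem_head orbT.
    by rewrite [X in _ || X]inE [X in _ || (_ || X)]inE eqxx !orbT.
apply: (local_move_writhe lm lK lK') => C C_out.
rewrite /X /=; set c := crossing_at _ _ _; set c' := crossing_at _ _ _.
have same d : d \in C -> linked c d = linked c' d /\ linked d c = linked d c'.
  by move=> /C_out[d1 d2]; exact: (linked_same_strands h ord0 ord_max sK' sK'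
    u_in v_in d1 d2).
have cc : crossing_chord K' c by exact: (crossing_at_chord h_inj sK' stackedK'
  n01 u_in gu).
have cc' : crossing_chord K' c'
  by exact: (crossing_at_chord h_inj sK' stackedK' n01 v_in gv).
have linked_cc' : linked c c' = linked c' c.
  rewrite /c /c' !linked_crossings /=.
  have ne i j : tau' i u != tau' j v.
    have [->|ij] := eqVneq i j; last first.
      by have [] := sys_disjoint sK' ij (sys_timeW sK' i u_in)
        (sys_timeW sK' j v_in).
    apply: contraTneq uv => e1; rewrite -(sys_timeK sK' j u_in) e1.
    by rewrite (sys_timeK sK' j v_in) ltxx.
  by apply: linkedC => /=.
split.
  move=> d /same[_ dc]; rewrite /link_parity !big_cons !big_nil dc.
  by rewrite addbF addbb.
(* The two chords join the same strands, so they see [C] alike; each counts itself, and their mutual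
   linking is symmetric. They are odd together or even together. *)
have parity_cc' : link_parity c (C ++ [:: c; c']) = link_parity c'
  (C ++ [:: c; c']).
  rewrite !link_parity_cat; congr (_ (+) _).
    by rewrite /link_parity big_seq [RHS]big_seq; apply: eq_bigr => d /same[].
  rewrite /link_parity !big_cons !big_nil linked_cc'
    (linked_self (chord_neq cc)).
  by rewrite (linked_self (chord_neq cc')); case: (linked c' c).
rewrite big_nil !big_cons big_nil parity_cc' addr0.
case: ifP => _ //; rewrite !(crossing_at_sign smoothS _ sK')//.
have [_ g_start g_end] := ends ord0; have [_ g_start' g_end'] := ends ord_max.
have su : sgz (slope g ord0 ord_max u) = -1.
  apply: (slope_first_crossing smoothS sK') => //.
    by rewrite g_start g_start'; apply: f_lt; lra.
  move=> z /andP[z1 zu]; apply/eqP => /gE.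
  rewrite z1 (le_trans (ltW zu)) ?(ltW (lt_trans uv v1))// => /(_ isT)[] zE.
    by rewrite zE ltxx in zu.
  by rewrite zE in zu; have := lt_trans zu uv; rewrite ltxx.
have sv : sgz (slope g ord0 ord_max v) = 1.
  apply: (slope_last_crossing smoothS sK') => //.
    by rewrite g_end g_end'; apply: f_lt; lra.
  move=> z /andP[vz z1]; apply/eqP => /gE.
  rewrite z1 andbT (le_trans _ (ltW vz)) ?(ltW (lt_trans u1 uv))// =>
    /(_ isT)[] zE.
    by rewrite zE in vz; have := lt_trans vz uv; rewrite ltxx.
  by rewrite zE ltxx in vz.
by rewrite su sv; ring.
Qed.

Lemma odd_writhe_Omega3 K K' : Omega3 K K' -> odd_writhe K = odd_writhe K'.
Proof.
move=> [phi [a [b [f [g [h]]]]]] /=.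
set i0 : 'I_3 := inord 0; set i1 : 'I_3 := inord 1; set i2 : 'I_3 := inord 2.
move=> [lm graphs [h_inj stackedK stackedK'] [f01 f12 _ _]].
move=> [[u01 [u02 [u12 [[U01 fE01] [U02 fE02] [U12 fE12] [u_lt1 u_lt2]]]]]].
move=> [v01 [v02 [v12 [[V01 gE01] [V02 gE02] [V12 gE12] [v_lt1 v_lt2]]]]].
have [dphi dK dK' KK'] := lm.
have [x [e [tau sK]]] := strand_system_exists dphi dK (fun i => (graphs i).1).
have [x' [e' [tau' sK']]] := strand_system_exists dphi dK'
  (fun i => (graphs i).2).
have ends := strand_system_ends sK sK' KK'.
have e'E : e' = e by apply/funext => i; have [] := ends i.
rewrite e'E in sK'.
have n01 : i0 != i1 by rewrite -val_eqE /= !inordK.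
have n02 : i0 != i2 by rewrite -val_eqE /= !inordK.
have n12 : i1 != i2 by rewrite -val_eqE /= !inordK.
have I3 (i : 'I_3) : [\/ i = i0, i = i1 | i = i2].
  case: i => [[|[|[|//]]] p]; [apply: Or31|apply: Or32|apply: Or33];
  by apply: val_inj; rewrite /= inordK.
have W (z : R) : -1 < z < 1 -> -1 <= z <= 1 by case/andP => /ltW -> /ltW ->.
pose X (w01 w02 w12 : R) : seq ('I_3 * 'I_3 * R) :=
  [:: (i0, i1, w01); (i0, i2, w02); (i1, i2, w12)].
have locals J F y t w01 w02 w12 : strand_system phi a b J F y e t ->
    stacked a b h J -> meet_once (F i0) (F i1) w01 ->
      meet_once (F i0) (F i2) w02 ->
    meet_once (F i1) (F i2) w12 -> uniq [:: w01; w02; w12] ->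
    lists_local_chords a b J [seq crossing_at h t p | p <- X w01 w02 w12].
  move=> sJ stackedJ [W01 FE01] [W02 FE02] [W12 FE12] uw.
  apply: (lists_crossings h_inj sJ stackedJ) => //.
    move=> p; rewrite !inE => /or3P[] /eqP -> /=; split=> //.
    - by apply/FE01; rewrite ?W.
    - by apply/FE02; rewrite ?W.
    - by apply/FE12; rewrite ?W.
  move=> i j z ij z1 Fz; rewrite !inE !xpair_eqE.
  case: (I3 i) (I3 j) ij Fz => -> [] -> ij Fz; try by rewrite eqxx in ij.
  - by rewrite ((FE01 z z1).1 Fz) !eqxx.
  - by rewrite ((FE02 z z1).1 Fz) !eqxx ?orbT.
  - by rewrite ((FE01 z z1).1 (esym Fz)) !eqxx ?orbT.
  - by rewrite ((FE12 z z1).1 Fz) !eqxx ?orbT.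
  - by rewrite ((FE02 z z1).1 (esym Fz)) !eqxx ?orbT.
  - by rewrite ((FE12 z z1).1 (esym Fz)) !eqxx ?orbT.
have lK : lists_local_chords a b K
  [seq crossing_at h tau p | p <- X u01 u02 u12].
  apply: (locals _ f x) => //.
  by rewrite /= !inE !lt_eqF// (lt_trans u_lt1).
have lK' : lists_local_chords a b K'
  [seq crossing_at h tau' p | p <- X v01 v02 v12].
  apply: (locals _ g x') => //.
  by rewrite /= !inE !gt_eqF// (lt_trans v_lt1).
(* The value involves only heights and directions, which both diagrams share. The last factor is the
   slope at the unique meeting of two graphs that start with [F i] below [F j]. *)
have sign J F y t i j w : strand_system phi a b J F y e t -> i != j ->
    F i (-1) < F j (-1) -> meet_once (F i) (F j) w ->
    chord_sign J (crossing_at h t (i, j, w)) =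
    (if (h j < h i)%N then 1 else -1) * (sgz (e i) * sgz (e j) * -1).
  move=> sJ ij Fij [w1 FE]; have Fw : F i w = F j w by apply/FE; rewrite ?W.
  rewrite (crossing_at_sign smoothS _ sJ)// (slope_first_crossing smoothS sJ)//.
  move=> z /andP[z1 zw]; have zW : -1 <= z <= 1.
    by case/andP: w1 => _ w1; rewrite z1 (ltW (lt_trans zw w1)).
  by apply/eqP => /(FE z zW) zE; rewrite zE ltxx in zw.
have [_ g0 _] := ends i0; have [_ g1 _] := ends i1; have [_ g2 _] := ends i2.
have f02 := lt_trans f01 f12.
have turn := fun i j k l u u' v v' => @linked_turn R S phi 3 a b h K
  K' f g x x' e
  tau tau' i j k l u u' v v' sK sK'.
have u_lt := lt_trans u_lt1 u_lt2; have v_lt := lt_trans v_lt1 v_lt2.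
apply: (local_move_writhe lm lK lK') => C C_out.
rewrite /X /=.
set c01 := crossing_at h tau (i0, i1, _);
  set c02 := crossing_at h tau (i0, i2, _).
set c12 := crossing_at h tau (i1, i2, _).
set c01' := crossing_at h tau' (i0, i1, _);
  set c02' := crossing_at h tau' (i0, i2, _).
set c12' := crossing_at h tau' (i1, i2, _).
have same d : d \in C -> [/\ linked c01 d = linked c01' d,
    linked c02 d = linked c02' d & linked c12 d = linked c12' d] /\
    [/\ linked d c01 = linked d c01',
    linked d c02 = linked d c02' & linked d c12 = linked d c12'].
  move=> /C_out[d1 d2].
  have [e1 e1'] := linked_same_strands h i0 i1 sK sK' U01 V01 d1 d2.
  have [e2 e2'] := linked_same_strands h i0 i2 sK sK' U02 V02 d1 d2.
  by have [e3 e3'] := linked_same_strands h i1 i2 sK sK' U12 V12 d1 d2.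
have self i j t w J F y : strand_system phi a b J F y e t -> i != j ->
  -1 < w < 1 ->
    linked (crossing_at h t (i, j, w)) (crossing_at h t (i, j, w)).
  move=> sJ ij w1; rewrite linked_crossings /=; apply: linked_self => /=.
  by have [] := sys_disjoint sJ ij (sys_timeW sJ i w1) (sys_timeW sJ j w1).
have n10 : i1 != i0 by rewrite eq_sym.
have n20 : i2 != i0 by rewrite eq_sym.
have n21 : i2 != i1 by rewrite eq_sym.
have once : (((i0 == i0) (+) (i1 == i0)) (+) ((i0 == i2) (+) (i1 == i2))) by
  rewrite eqxx !(negbTE n10, negbTE n02, negbTE n12).
split.
  by move=> d /same[_ [e1 e2 e3]];
    rewrite /link_parity !big_cons big_nil e1 e2 e3.
rewrite !big_cons !big_nil.
rewrite (sign _ _ _ _ _ _ _ sK n01 f01 (conj U01 fE01)).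
rewrite (sign _ _ _ _ _ _ _ sK n02 f02 (conj U02 fE02)).
rewrite (sign _ _ _ _ _ _ _ sK n12 f12 (conj U12 fE12)).
rewrite !(sign _ _ _ _ _ _ _ sK') ?g0 ?g1 ?g2 //.
have same_C c c' : (forall d, d \in C -> linked c d = linked c' d) ->
    link_parity c C = link_parity c' C.
  by move=> cd; rewrite /link_parity big_seq [RHS]big_seq; apply: eq_bigr.
rewrite !link_parity_cat.
rewrite (same_C c01 c01'); last by move=> d /same[[]].
rewrite (same_C c02 c02'); last by move=> d /same[[]].
rewrite (same_C c12 c12'); last by move=> d /same[[]].
rewrite /link_parity !big_cons !big_nil.
have s1 : linked c01 c01 by exact: (self _ _ _ _ _ _ _ sK n01 U01).
have s2 : linked c02 c02 by exact: (self _ _ _ _ _ _ _ sK n02 U02).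
have s3 : linked c12 c12 by exact: (self _ _ _ _ _ _ _ sK n12 U12).
have s1' : linked c01' c01' by exact: (self _ _ _ _ _ _ _ sK' n01 V01).
have s2' : linked c02' c02' by exact: (self _ _ _ _ _ _ _ sK' n02 V02).
have s3' : linked c12' c12' by exact: (self _ _ _ _ _ _ _ sK' n12 V12).
rewrite s1 s2 s3 s1' s2' s3'.
have E := (eqxx, negbTE n01, negbTE n02, negbTE n12, negbTE n10, negbTE n20,
  negbTE n21).
(* Any two of the three pairs have exactly one strand in common, and the order of all three
   abscissae is reversed by the move. *)
have -> : linked c01 c02 = ~~ linked c01' c02'.
  by apply: turn; rewrite ?E //; left.
have -> : linked c01 c12 = ~~ linked c01' c12'.
  by apply: turn; rewrite ?E //; left.
have -> : linked c02 c01 = ~~ linked c02' c01'.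
  by apply: turn; rewrite ?E //; right.
have -> : linked c02 c12 = ~~ linked c02' c12'.
  by apply: turn; rewrite ?E //; left.
have -> : linked c12 c01 = ~~ linked c12' c01'.
  by apply: turn; rewrite ?E //; right.
have -> : linked c12 c02 = ~~ linked c12' c02'.
  by apply: turn; rewrite ?E //; right.
(* Each of the three parities now contains two negated terms, whose negations cancel. *)
by do 6!case: (linked _ _).
Qed.

Lemma odd_writhe_Omega K K' : Omega_move K K' -> odd_writhe K = odd_writhe K'.
Proof.
by case=> [/odd_writhe_Omega1|/odd_writhe_Omega2|/odd_writhe_Omega3].
Qed.

Lemma odd_writhe_classical_equivalent K K' :
  classical_equivalent K K' -> odd_writhe K = odd_writhe K'.
Proof.
apply: clos_refl_sym_trans_invariant => J J' [_ _ []].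
- exact: odd_writhe_reparametrization.
- exact: odd_writhe_isotopy.
- exact: odd_writhe_Omega.
Qed.

End CrossingMoves.

Theorem theorem4p3 (R : realType) :
  (forall K K' : diagram (sphere R),
     virtually_equivalent K K' -> odd_writhe K = odd_writhe K') /\
  (forall K K' : diagram (sphere R),
     classical_diagram K -> classical_diagram K' ->
     classical_equivalent K K' -> odd_writhe K = odd_writhe K') /\
  (forall K K' : diagram (plane R),
     classical_diagram K -> classical_diagram K' ->
     classical_equivalent K K' -> odd_writhe K = odd_writhe K').
Proof.
have sphereS := @smooth_sphere R.
split; last split.
- apply: clos_refl_sym_trans_invariant => J J' [].
  + exact: odd_writhe_reparametrization.
  + exact: odd_writhe_isotopy.
  + exact: odd_writhe_Omega.
  + by case; [exact: odd_writhe_detour|exact: odd_writhe_Omega_v].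
- by move=> K K' _ _; exact: odd_writhe_classical_equivalent.
- by move=> K K' _ _; apply: odd_writhe_classical_equivalent;
  exact: smooth_plane.
Qed.
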